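(* Let $\mu,\mu',\nu,\nu'\in\mathcal M$ with $\mu(\mathbb R)=\mu'(\mathbb R)$ and $\nu(\mathbb R)=\nu'(\mathbb R)$. Suppose $\mu\leq_{pcd}\nu$ and $\mu'\leq_{pcd}\nu'$. Then $$W\big(S^\nu(\mu),S^{\nu'}(\mu')\big)\leq W(\mu,\mu')+2W(\nu,\nu').$$
   Context: $\mathcal M$ is the set of finite positive Borel measures on $\mathbb R$ with finite first moment. For $\eta,\chi\in\mathcal M$: $\eta\leq\chi$ means $\eta(A)\leq\chi(A)$ for all Borel $A$; $\eta\leq_{cd}\chi$ means $\int f\,d\eta\leq\int f\,d\chi$ for all convex non-increasing $f:\mathbb R\to\mathbb R$ (this forces equal total mass); $\eta\leq_{pcd}\chi$ means $\int f\,d\eta\leq\int f\,d\chi$ for all non-negative, convex, non-increasing $f:\mathbb R\to[0,\infty)$. Shadow measure: if $\mu\leq_{pcd}\nu$, then (known fact) there is a unique measure $S^\nu(\mu)\in\mathcal M$ such that $\mu\leq_{cd}S^\nu(\mu)\leq\nu$ and $S^\nu(\mu)\leq_{cd}\theta$ for every $\theta\in\mathcal M$ with $\mu\leq_{cd}\theta\leq\nu$. For $\eta,\chi\in\mathcal M$ of equal mass, $W(\eta,\chi)=\sup_f\left|\int f\,d\eta-\int f\,d\chi\right|$, the supremum being over all 1-Lipschitz $f:\mathbb R\to\mathbb R$. *)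

(* Defs.v *)
From HB Require Import structures.
From mathcomp Require Import all_boot all_order all_algebra.
From mathcomp Require Import all_classical all_reals all_analysis.

Set Implicit Arguments.
Unset Strict Implicit.
Unset Printing Implicit Defensive.

Import Order.TTheory GRing.Theory Num.Theory.
Import numFieldNormedType.Exports.

Local Open Scope classical_set_scope.
Local Open Scope ring_scope.

Notation finite_borel R := {finite_measure set (measurableTypeR R) -> \bar R}.

Definition finite_first_moment (R : realType) (eta : finite_borel R) : Prop :=
  eta.-integrable setT (fun x : measurableTypeR R => (x : R)%:E).

Definition setwise_le (R : realType) (eta chi : finite_borel R) : Prop :=
  forall A : set (measurableTypeR R), measurable A -> (eta A <= chi A)%E.

Definition convex_nonincreasing (R : realType) (f : R -> R) : Prop :=
  convex_function (setT : set (convex_lmodType R^o)) f /\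
  {homo f : x y /~ x <= y}.

(* A convex non-increasing f lies above an affine function, so its negative
   part is integrable against a measure with finite first moment: on such
   measures the integrals below are well defined in ]-oo, +oo]. *)
Definition cd_le (R : realType) (eta chi : finite_borel R) : Prop :=
  forall f : R -> R, convex_nonincreasing f ->
    (\int[eta]_x (f x)%:E <= \int[chi]_x (f x)%:E)%E.

Definition pcd_le (R : realType) (eta chi : finite_borel R) : Prop :=
  forall f : R -> R, convex_nonincreasing f -> (forall x, 0 <= f x) ->
    (\int[eta]_x (f x)%:E <= \int[chi]_x (f x)%:E)%E.

(* [is_shadow nu mu S] is the defining property of S = S^nu(mu). *)
Definition is_shadow (R : realType) (nu mu S : finite_borel R) : Prop :=
  [/\ finite_first_moment S,
      cd_le mu S,
      setwise_le S nu
    & forall theta : finite_borel R, finite_first_moment theta ->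
        cd_le mu theta -> setwise_le theta nu -> cd_le S theta].

Definition W1 (R : realType) (eta chi : finite_borel R) : \bar R :=
  ereal_sup [set `|\int[eta]_x (f x)%:E - \int[chi]_x (f x)%:E|%E
            | f in [set f : R -> R | 1.-lipschitz (f : R -> R^o)]].

(* Main.v *)
(** Write [P_eta k] for the integral of [(k - x)^+] against [eta], and [conv g]
    for the largest convex minorant of [g].  The shadow [S] of [mu] in [nu]
    satisfies [P_S = P_nu - conv (P_nu - P_mu)]: the function [P_nu - P_S] is a
    convex minorant of [P_nu - P_mu], and conversely [P_nu - conv (P_nu - P_mu)]
    is convex and is the potential of an admissible measure, so minimality of
    [S] applies.  The distance [W1 eta chi] is the total variation of
    [P_eta - P_chi].  The operator [conv] is nonexpansive for the total variation
    of a difference: if [g' - g = h - h'] with [h], [h'] nondecreasing, then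
    [conv (g + h) - conv g] and [conv (g' + h') - conv g'] are nondecreasing with
    values in [0, sup h] and [0, sup h'], and [g + h = g' + h'].  Applied to
    [g = P_nu - P_mu] and [g' = P_nu' - P_mu'] this bounds the variation of
    [conv g - conv g'] by [W1 mu mu' + W1 nu nu']; the remaining term
    [P_nu - P_nu'] of [P_S - P_S'] contributes another [W1 nu nu']. *)

Require Import Defs.
From HB Require Import structures.
From mathcomp Require Import all_boot all_order all_algebra.
From mathcomp Require Import all_classical all_reals all_analysis.
From mathcomp Require Import measurable_realfun ring lra.

Set Implicit Arguments.
Unset Strict Implicit.
Unset Printing Implicit Defensive.

Import Order.TTheory GRing.Theory Num.Theory.
Import numFieldNormedType.Exports.

Local Open Scope classical_set_scope.
Local Open Scope ring_scope.

(** * Convex minorants and subgradients *)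

Section convex_functions.
Variable R : realType.
Implicit Types (f g h A B C psi F : R -> R).

(** The chord inequality multiplied by [y - x]: free of quotients and convex weights, hence within
    reach of linear arithmetic. *)
Definition cvx f := forall x z y, x <= z -> z <= y ->
  (y - x) * f z <= (y - z) * f x + (z - x) * f y.

Lemma cvx_cst c : cvx (fun=> c).
Proof. by move=> x z y xz zy; lra. Qed.

Lemma cvx_add_affine f a b : cvx f -> cvx (fun x => f x + (a * x + b)).
Proof. by move=> cf x z y xz zy; have := cf x z y xz zy; lra. Qed.

(** A segment that leaves [I] meets a point where [psi] is below [C]. So [z] in [I] has a point on
    each side at which [psi] is below the chord of the glued function, and convexity of [psi]
    between these two points handles [psi z]. *)
Lemma cvx_glue C psi (I : set R) : cvx C -> cvx psi ->
  (forall x z, ~ I x -> I z ->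
    exists2 e, Num.min x z <= e <= Num.max x z & psi e <= C e) ->
  cvx (fun x => if x \in I then Num.max (C x) (psi x) else C x).
Proof.
move=> cC cpsi Iends x z y xz zy.
pose Phi w := if w \in I then Num.max (C w) (psi w) else C w.
have CPhi w : C w <= Phi w by rewrite /Phi; case: ifP => // _; rewrite le_max lexx.
have psiPhi w : I w -> psi w <= Phi w.
  by move=> Iw; rewrite /Phi mem_set// le_max lexx orbT.
have CL w : x <= w -> w <= y ->
    (y - x) * C w <= (y - w) * Phi x + (w - x) * Phi y.
  move=> xw wy; apply: le_trans (cC x w y xw wy) _.
  by rewrite lerD// ler_wpM2l ?subr_ge0.
change ((y - x) * Phi z <= (y - z) * Phi x + (z - x) * Phi y).
have [Iz|nIz] := pselect (I z); last first.
  by rewrite {1}/Phi memNset//; exact: CL.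
rewrite {1}/Phi mem_set// maxr_pMr ?subr_ge0 ?(le_trans xz)//.
rewrite ge_max CL//=.
(* [e1] is [x] itself when [x] lies in [I]; otherwise [Iends] provides it, and there [psi <= C]
   while [CL] puts [C] below the chord. [e2] is its mirror image. *)
have [e1 /andP[xe1 e1z] pe1] : exists2 e1, x <= e1 <= z &
    (y - x) * psi e1 <= (y - e1) * Phi x + (e1 - x) * Phi y.
  have [Ix|nIx] := pselect (I x).
    exists x; rewrite ?lexx// subrr mul0r addr0.
    by rewrite ler_wpM2l ?psiPhi// subr_ge0 (le_trans xz).
  have [e] := Iends _ _ nIx Iz.
  rewrite (min_idPl xz) (max_idPr xz) => /andP[xe ez] pe.
  exists e; rewrite ?xe//; apply: le_trans (CL _ xe (le_trans ez zy)).
  by rewrite ler_wpM2l// subr_ge0 (le_trans xz).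
have [e2 /andP[ze2 e2y] pe2] : exists2 e2, z <= e2 <= y &
    (y - x) * psi e2 <= (y - e2) * Phi x + (e2 - x) * Phi y.
  have [Iy|nIy] := pselect (I y).
    exists y; rewrite ?lexx ?andbT// subrr mul0r add0r.
    by rewrite ler_wpM2l ?psiPhi// subr_ge0 (le_trans xz).
  have [e] := Iends _ _ nIy Iz.
  rewrite (min_idPr zy) (max_idPl zy) => /andP[ze ey] pe.
  exists e; rewrite ?ze//; apply: le_trans (CL _ (le_trans xz ze) ey).
  by rewrite ler_wpM2l// subr_ge0 (le_trans xz).
have [e12|e12] := eqVneq e1 e2.
  by have -> : z = e1 by apply/eqP; rewrite eq_le e1z e12 ze2.
have e12' : 0 < e2 - e1 by rewrite subr_gt0 lt_neqAle e12 (le_trans e1z).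
rewrite -(ler_pM2l e12').
have h1 := cpsi e1 z e2 e1z ze2.
have xy : 0 <= y - x by rewrite subr_ge0 (le_trans xz).
have {}h1 := ler_wpM2l xy h1.
have h2 := ler_wpM2l (etrans (subr_ge0 _ _) ze2) pe1.
have h3 := ler_wpM2l (etrans (subr_ge0 _ _) e1z) pe2.
lra.
Qed.

(* The largest convex minorant of [g], meaningful when [g] has a convex
   minorant (here [g >= 0]); [sup] of an empty set is [0]. *)
Definition hull g x :=
  sup [set v | exists f, [/\ cvx f, (forall y, f y <= g y) & v = f x]].

Lemma hull_max g f x : cvx f -> (forall y, f y <= g y) -> f x <= hull g x.
Proof.
move=> cf fg; apply: ub_le_sup; last by exists f.
by exists (g x) => _ [k [_ kg ->]].
Qed.

Lemma hull_least g x c : (forall y, 0 <= g y) ->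
  (forall f, cvx f -> (forall y, f y <= g y) -> f x <= c) -> hull g x <= c.
Proof.
move=> g0 H; apply: ge_sup; first by exists 0, (fun=> 0); split=> //; exact: cvx_cst.
by move=> _ [f [cf fg ->]]; exact: H.
Qed.

Lemma hull_le g x : (forall y, 0 <= g y) -> hull g x <= g x.
Proof. by move=> g0; apply: hull_least. Qed.

Lemma hull_ge0 g x : (forall y, 0 <= g y) -> 0 <= hull g x.
Proof. by move=> g0; apply: (@hull_max g (fun=> 0)) => //; exact: cvx_cst. Qed.

Lemma cvx_hull g : (forall y, 0 <= g y) -> cvx (hull g).
Proof.
move=> g0 x z y xz zy.
have [->|xy] := eqVneq x y; first by lra.
have xy' : 0 < y - x by rewrite subr_gt0 lt_neqAle xy (le_trans xz).
rewrite mulrC -ler_pdivlMr//; apply: hull_least => // f cf fg.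
rewrite ler_pdivlMr// mulrC; apply: le_trans (cf x z y xz zy) _.
by rewrite lerD// ler_wpM2l ?subr_ge0// hull_max.
Qed.

Lemma le_hull g h x : (forall y, 0 <= g y) -> (forall y, g y <= h y) ->
  hull g x <= hull h x.
Proof.
move=> g0 gh; apply: hull_least => // f cf fg; apply: hull_max => // y.
exact: le_trans (gh y).
Qed.

Lemma hull_le_addC g h c x : (forall y, 0 <= h y) ->
  (forall y, h y <= g y + c) -> hull h x <= hull g x + c.
Proof.
move=> h0 hg; apply: hull_least => // f cf fh; rewrite -lerBlDr.
have := @hull_max g (fun y => f y + (0 * y - c)) x (cvx_add_affine 0 (- c) cf).
rewrite mul0r add0r; apply => y; rewrite mul0r add0r lerBlDr.
exact: le_trans (hg y).
Qed.

(* Isotonicity of the convex hull for the order "the difference is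
   nondecreasing".  If [hull (g + h) - hull g] fell below a level [D] between
   [a] and [b], then at the point where [h] crosses [D] one of the two hulls
   could be enlarged by gluing in a vertical translate of the other one. *)
Lemma hull_add_nondecreasing g h a b : (forall y, 0 <= g y) ->
  (forall y, 0 <= g y + h y) -> {homo h : x y / x <= y} -> a <= b ->
  hull (g \+ h) a - hull g a <= hull (g \+ h) b - hull g b.
Proof.
move=> g0 gh0 hnd ab; rewrite leNgt; apply/negP.
set C := hull g; set C' := hull (g \+ h) => uab.
have [D Da Db] : exists2 D : R, D < C' a - C a & C' b - C b < D.
  by exists ((C' a - C a + (C' b - C b)) / 2); lra.
have cC : cvx C by exact: cvx_hull.
have cC' : cvx C' by exact: cvx_hull.
(* Gluing [C + D] into [C'] on [[p, +oo[] gives a convex minorant of [g + h] that exceeds [C'] at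
   [b]. At [p] itself [Cp] makes it a minorant. [left] glues [C' - D] into [C] and contradicts
   maximality at [a]. *)
have right p : p <= b -> (forall x, p < x -> D <= h x) -> C p + D <= C' p -> False.
  move=> pb hD Cp.
  pose Phi x := if x \in `[p, +oo[%classic then Num.max (C' x) (C x + (0 * x + D)) else C' x.
  have : Phi b <= C' b.
    apply: hull_max.
      apply: cvx_glue => //; first exact: cvx_add_affine.
      move=> x z; rewrite /= !in_itv/= !andbT => /negP; rewrite -ltNge => xp pz.
      exists p; rewrite ?mul0r ?add0r//.
      by rewrite ge_min le_max (ltW xp) pz orbT.
    move=> x; rewrite /Phi; case: ifPn => [|_]; last exact: hull_le.
    rewrite inE /= in_itv/= andbT mul0r add0r le_eqVlt ge_max => /orP[/eqP<-|px].
      by rewrite hull_le//= (le_trans Cp)// hull_le.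
    by rewrite hull_le//= lerD ?hull_le ?hD.
  rewrite /Phi mem_set/= ?in_itv/= ?pb//.
  rewrite ge_max => /andP[_]; lra.
have left p : a <= p -> (forall x, x < p -> h x <= D) -> C' p - D <= C p -> False.
  move=> pb hD Cp.
  pose Phi x := if x \in `]-oo, p]%classic then Num.max (C x) (C' x + (0 * x - D)) else C x.
  have : Phi a <= C a.
    apply: hull_max.
      apply: cvx_glue => //; first exact: cvx_add_affine.
      move=> x z; rewrite /= !in_itv/= => /negP; rewrite -ltNge => xp pz.
      exists p; rewrite ?mul0r ?add0r//.
      by rewrite ge_min le_max (ltW xp) pz orbT.
    move=> x; rewrite /Phi; case: ifPn => [|_]; last exact: hull_le.
    rewrite inE /= in_itv/= mul0r add0r le_eqVlt ge_max => /orP[/eqP->|px].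
      by rewrite hull_le//= (le_trans Cp)// hull_le.
    rewrite hull_le//= lerBlDr (le_trans (hull_le _ _))//= lerD//.
    exact: hD.
  rewrite /Phi mem_set/= ?in_itv/= ?pb//.
  rewrite ge_max => /andP[_]; lra.
have [hDa|hDa] := leP D (h a).
  apply: (right a) => // [x ax|].
    by apply: le_trans hDa _; apply/hnd/ltW.
  by lra.
have [hDb|hDb] := ltP (h b) D.
  apply: (left b) => // [x xb|].
    by apply: le_trans (ltW hDb); apply/hnd/ltW.
  by lra.
(* [sup E] is where [h] crosses the level [D]. The value of [h] there stays unknown; comparing the
   two hulls at this point decides between [right] and [left]. *)
pose E := [set x | h x < D].
have ubE : ubound E b.
  move=> x /= hx; rewrite leNgt; apply/negP => /ltW /hnd.
  by rewrite leNgt (lt_le_trans hx hDb).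
have supE : has_sup E by split; [exists a|exists b].
have ap : a <= sup E by apply: ub_le_sup => //; exists b.
have pb : sup E <= b by apply: ge_sup => //; exists a.
have [Cp|Cp] := leP (C (sup E) + D) (C' (sup E)).
  apply: (right (sup E)) => // x px; rewrite leNgt; apply/negP => hx.
  have : x <= sup E by apply: ub_le_sup => //; exists b.
  by rewrite leNgt px.
apply: (left (sup E)) => //; last by lra.
move=> x xp; have [e Ee xe] := sup_gt (ex_intro _ a hDa) xp.
by apply: le_trans (ltW Ee); apply/hnd/ltW.
Qed.

(* Competitor: on [x1, x2] replace the hull by [A] minus the chord of
   [A - hull (A - B)], which lies above [B] at the end points, hence inside. *)
Lemma cvx_sub_hull A B : cvx A -> cvx B -> (forall y, 0 <= A y - B y) ->
  cvx (A \- hull (A \- B)).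
Proof.
move=> cA cB AB0 x z y xz zy /=; set C := hull _.
have [->|xy] := eqVneq x y; first by lra.
have xy' : 0 < y - x by rewrite subr_gt0 lt_neqAle xy (le_trans xz).
(* [s] and [c] encode the chord of [A - C] over [[x, y]]: [A w + (- s * w + c)] is [A w] minus that
   chord. It equals [C] at [x] and [y], which is the gluing condition. *)
pose s := ((A y - C y) - (A x - C x)) / (y - x).
have sE : s * (y - x) = (A y - C y) - (A x - C x) by rewrite /s divfK ?gt_eqF.
pose c := - (A x - C x) + s * x.
have CAB w : C w <= A w - B w by exact: hull_le.
have BL w : x <= w -> w <= y -> B w <= (A x - C x) + s * (w - x).
  move=> xw wy; rewrite -(ler_pM2l xy').
  apply: le_trans (cB _ _ _ xw wy) _.
  have h1 : (y - w) * B x <= (y - w) * (A x - C x).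
    by rewrite ler_wpM2l ?subr_ge0//; have := CAB x; lra.
  have h2 : (w - x) * B y <= (w - x) * (A y - C y).
    by rewrite ler_wpM2l ?subr_ge0//; have := CAB y; lra.
  have -> : (y - x) * (A x - C x + s * (w - x)) =
     (y - w) * (A x - C x) + (w - x) * (A y - C y).
    have -> : A y - C y = s * (y - x) + (A x - C x) by lra.
    ring.
  lra.
pose Phi w := if w \in `[x, y]%classic then Num.max (C w) (A w + (- s * w + c)) else C w.
have : Phi z <= C z.
  apply: hull_max.
    apply: cvx_glue; [exact: cvx_hull|exact: cvx_add_affine|].
    move=> u v; rewrite /= !in_itv/= => /negP; rewrite negb_and -!ltNge.
    move=> + /andP[xv vy] => /orP[ux|yu].
      exists x; first by rewrite ge_min le_max (ltW ux) xv orbT.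
      by rewrite /c; lra.
    exists y; first by rewrite ge_min le_max (ltW yu) vy orbT.
    by rewrite /c; lra.
  move=> w; rewrite /Phi; case: ifPn => [|_]; last exact: CAB.
  rewrite inE /= in_itv/= ge_max => /andP[xw wy]; rewrite CAB/=.
  have := BL _ xw wy; rewrite /c; lra.
rewrite /Phi mem_set/= ?in_itv/= ?xz//.
rewrite ge_max => /andP[_].
rewrite -(ler_pM2l xy') => H.
have : (y - x) * (A z + (- s * z + c)) =
  (y - x) * A z - ((y - z) * (A x - C x) + (z - x) * (A y - C y)).
  have -> : A y - C y = s * (y - x) + (A x - C x) by lra.
  by rewrite /c; ring.
lra.
Qed.

(** * Subgradients and right derivatives *)

Definition subgradient F f := forall a b, F a * (b - a) <= f b - f a.

(** For nondecreasing [F] this is right-continuity: one point [b] controls all of [[a, b]]. *)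
Definition rcont F := forall a e, 0 < e -> exists2 b, a < b & F b <= F a + e.

Lemma subgradient_nondecreasing F f : subgradient F f -> {homo F : x y / x <= y}.
Proof.
move=> Ff x y; rewrite le_eqVlt => /orP[/eqP->//|xy].
have h1 := Ff x y; have h2 := Ff y x.
have xy' : 0 < y - x by rewrite subr_gt0.
rewrite -(ler_pM2r xy'); lra.
Qed.

Lemma subgradientD F f G g : subgradient F f -> subgradient G g ->
  subgradient (F \+ G) (f \+ g).
Proof. by move=> Ff Gg a b /=; have := Ff a b; have := Gg a b; lra. Qed.

Lemma rcontD F G : {homo F : x y / x <= y} -> {homo G : x y / x <= y} ->
  rcont F -> rcont G -> rcont (F \+ G).
Proof.
move=> ndF ndG rF rG a e e0.
have e2 : 0 < e / 2 by rewrite divr_gt0.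
have [b ab Fb] := rF a _ e2; have [c ac Gc] := rG a _ e2.
exists (Num.min b c); first by rewrite lt_min ab.
have := ndF (Num.min b c) b; have := ndG (Num.min b c) c.
rewrite !ge_min !lexx orbT => /(_ isT) h1 /(_ isT) h2 /=; lra.
Qed.

(** For [b > x] the slope of [f] from [x] to [b] lies between [F x] and [G b]; let [b] decrease to
    [x]. Applied both ways, it identifies two right-continuous subgradients. *)
Lemma subgradient_le F G f : subgradient F f -> subgradient G f -> rcont G ->
  forall x, F x <= G x.
Proof.
move=> Ff Gf rG x; apply/ler_addgt0Pl => e /(rG x) [b xb Gb].
rewrite addrC; apply: le_trans Gb.
have xb' : 0 < b - x by rewrite subr_gt0.
by rewrite -(ler_pM2r xb'); have := Ff x b; have := Gf b x; lra.
Qed.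

(** On [[a, b]] the increments of [f] and [g] differ by at most [(F b - F a) * (b - a)]. Bisection
    halves the lengths while the increments of [F] telescope, so the bound can be divided by any
    power of 2. *)
Lemma subgradient_diff F f g : subgradient F f -> subgradient F g ->
  forall x y, f x - g x = f y - g y.
Proof.
move=> Ff Fg.
suff main x y : x <= y -> f x - g x = f y - g y.
  by move=> x y; have [/main//|/ltW/main] := leP x y.
move=> xy.
have bound n : forall a b, a <= b ->
    `|(f b - g b) - (f a - g a)| <= (F b - F a) * (b - a) / 2 ^+ n.
  elim: n => [|n IH] a b ab.
    rewrite expr0 divr1 ler_norml.
    have := Ff a b; have := Ff b a; have := Fg a b; have := Fg b a; lra.
  pose m := (a + b) / 2.
  have am : a <= m by rewrite /m; lra.
  have mb : m <= b by rewrite /m; lra.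
  have -> : (f b - g b) - (f a - g a) =
    ((f b - g b) - (f m - g m)) + ((f m - g m) - (f a - g a)) by lra.
  apply: le_trans (ler_normD _ _) _.
  apply: le_trans (lerD (IH _ _ mb) (IH _ _ am)) _.
  rewrite -mulrDl exprS invfM mulrA ler_wpM2r ?invr_ge0 ?exprn_ge0//.
  rewrite /m; nra.
apply/eqP; rewrite eq_sym -subr_eq0 -normr_eq0 eq_le normr_ge0 andbT.
set K := (F y - F x) * (y - x) in bound.
have K0 : 0 <= K by rewrite mulr_ge0 ?subr_ge0 ?(subgradient_nondecreasing Ff).
rewrite leNgt; apply/negP => d0; set d := `|_| in d0 bound.
have := @upper_nthrootP R (K / d) _ (leqnn _).
set n := Num.bound _; rewrite ltNge => /negP; apply.
by rewrite ler_pdivlMr// mulrC -ler_pdivlMr ?exprn_gt0//; exact: bound.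
Qed.

(** For convex [f] this is the right derivative: the slopes are nondecreasing in [b], so their
    infimum is their limit at [a]. *)
Definition right_slope f a := inf [set (f b - f a) / (b - a) | b in `]a, +oo[%classic].

Lemma right_slope_subgradient f : cvx f -> subgradient (right_slope f) f.
Proof.
move=> cf a b; have slopes c d : c < a -> a < d ->
    (f a - f c) / (a - c) <= (f d - f a) / (d - a).
  move=> ca ad; rewrite ler_pdivrMr ?subr_gt0// mulrAC ler_pdivlMr ?subr_gt0//.
  have := cf c a d (ltW ca) (ltW ad); lra.
have [ab|ba|->] := ltgtP a b; last by rewrite !subrr mulr0.
  rewrite -ler_pdivlMr ?subr_gt0//; apply: ge_inf.
    exists ((f a - f (a - 1)) / (a - (a - 1))) => _ [d /= + <-].
    by rewrite in_itv/= andbT => ad; apply: slopes => //; lra.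
  by exists b => //=; rewrite in_itv/= ab.
rewrite -opprB mulrN -(opprB (f a)) lerN2 -ler_pdivrMr ?subr_gt0//.
apply: lb_le_inf.
  by exists ((f (a + 1) - f a) / (a + 1 - a)), (a + 1) => //=; rewrite in_itv/=; lra.
by move=> _ [d /= + <-]; rewrite in_itv/= andbT => ad; apply: slopes.
Qed.

Lemma right_slope_rcont f : cvx f -> rcont (right_slope f).
Proof.
move=> cf a e e0; have sub := right_slope_subgradient cf.
have : right_slope f a < right_slope f a + e / 2 by rewrite ltrDl divr_gt0.
move=> /inf_lt[].
  by exists ((f (a + 1) - f a) / (a + 1 - a)), (a + 1) => //=; rewrite in_itv/=; lra.
move=> _ [b /= + <-]; rewrite in_itv/= andbT => ab.
have ab' : 0 < b - a by rewrite subr_gt0.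
rewrite ltr_pdivrMr// => H.
(* At the midpoint [y], [b - a] is twice [b - y]; this factor turns the slack [e / 2] of the slope
   from [a] to [b] into [e]. *)
exists ((a + b) / 2); first by lra.
have yb : 0 < b - (a + b) / 2 by lra.
rewrite -(ler_pM2r yb).
have := sub ((a + b) / 2) b; have := sub a ((a + b) / 2).
set y := right_slope f _; set Fa := right_slope f a.
rewrite -/Fa in H; lra.
Qed.
End convex_functions.

(** * Potentials and the Wasserstein distance *)

Section lipschitz_integrals.
Variable R : realType.
Implicit Types (f g : R -> R) (eta chi : finite_borel R).

Definition lip L f := forall x y, `|f x - f y| <= L * `|x - y|.

Lemma lip_cst c : lip 0 (fun=> c).
Proof. by move=> x y; rewrite subrr normr0 mul0r. Qed.

Lemma lipD L M f g : lip L f -> lip M g -> lip (L + M) (f \+ g).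
Proof.
move=> lf lg x y; rewrite mulrDl.
have -> : (f \+ g) x - (f \+ g) y = (f x - f y) + (g x - g y) by rewrite /=; lra.
by apply: le_trans (ler_normD _ _) _; rewrite lerD.
Qed.

Lemma lipZ L f c : lip L f -> lip (`|c| * L) (fun x => c * f x).
Proof. by move=> lf x y; rewrite -mulrBr normrM -mulrA ler_wpM2l. Qed.

Lemma lipN L f : lip L f -> lip L (\- f).
Proof. by move=> lf x y /=; rewrite -opprD normrN. Qed.

Definition put (k x : R) : R := Num.max (k - x) 0.

Lemma put_lip k : lip 1 (put k).
Proof.
move=> x y; rewrite mul1r /put ler_norml.
have := ler_norm (x - y); have := ler_norm (y - x); rewrite (distrC y x).
by case: (leP (k - x) 0); case: (leP (k - y) 0); lra.
Qed.

Lemma lip_continuous L f : lip L f -> continuous f.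
Proof.
move=> lf x; apply/cvgrPdist_le => e e0; near=> y.
apply: le_trans (lf _ _) _.
have L0 : 0 < `|L| + 1 by rewrite ltr_wpDl.
have : `|x - y| <= e / (`|L| + 1).
  near: y; apply: cvgr_dist_le; first exact: cvg_id.
  by rewrite divr_gt0.
rewrite ler_pdivlMr// mulrC; apply: le_trans.
by rewrite ler_wpM2r// (le_trans (ler_norm L))// lerDl.
Unshelve. all: by end_near. Qed.

Lemma lip_measurable L f : lip L f ->
  measurable_fun setT (f : measurableTypeR R -> R).
Proof. by move=> lf; apply: continuous_measurable_fun; exact: lip_continuous lf. Qed.

Lemma lip_norm_le L f x : lip L f -> `|f x| <= `|f 0| + L * `|x|.
Proof.
move=> lf; have -> : f x = f 0 + (f x - f 0) by lra.
by apply: le_trans (ler_normD _ _) _; rewrite lerD2l; have := lf x 0; rewrite subr0.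
Qed.

Lemma integrable_affine_norm eta a b : finite_first_moment eta ->
  eta.-integrable setT (fun x : measurableTypeR R => (a + b * `|x : R|)%:E).
Proof.
move=> m1; under eq_fun do rewrite EFinD EFinM.
apply: integrableD => //; first exact: finite_measure_integrable_cst.
by apply: integrableZl => //; exact: (integrable_abse m1).
Qed.

Lemma lip_integrable eta L f : finite_first_moment eta -> lip L f ->
  eta.-integrable setT (EFin \o (f : measurableTypeR R -> R)).
Proof.
move=> m1 lf; apply: le_integrable (integrable_affine_norm (`|f 0|) (`|L|) m1) => //.
  by apply/measurable_EFinP; exact: lip_measurable lf.
move=> x _ /=; rewrite lee_fin (ger0_norm (addr_ge0 _ (mulr_ge0 _ _)))//.
apply: le_trans (lip_norm_le x lf) _.
by rewrite lerD2l ler_wpM2r// ler_norm.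
Qed.

Lemma lip_integralE eta L f : finite_first_moment eta -> lip L f ->
  (\int[eta]_x (f x)%:E)%E = (\int[eta]_x f x)%:E.
Proof.
by move=> m1 lf; rewrite fineK//; apply: integrable_fin_num => //; exact: lip_integrable lf.
Qed.

Lemma W1_ge eta chi f B : finite_first_moment eta -> finite_first_moment chi ->
  (W1 eta chi <= B%:E)%E -> lip 1 f ->
  \int[eta]_x f x - \int[chi]_x f x <= B.
Proof.
move=> me mc WB lf; apply: le_trans (ler_norm _) _.
rewrite -lee_fin; apply: le_trans WB; apply: ereal_sup_ubound => /=.
exists f; first by move=> [x y] _; exact: lf.
by rewrite !(lip_integralE _ lf).
Qed.

(** Testing with both [f] and [- f] recovers the absolute value in [W1]. *)
Lemma W1_le eta chi B : finite_first_moment eta -> finite_first_moment chi ->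
  (forall f, lip 1 f -> \int[eta]_x f x - \int[chi]_x f x <= B) ->
  (W1 eta chi <= B%:E)%E.
Proof.
move=> me mc H; apply: ge_ereal_sup => _ [f /= klf <-].
have lf : lip 1 f by move=> x y; exact: (klf (x, y)).
rewrite !(lip_integralE _ lf)// lee_fin ler_norml (H _ lf) andbT.
rewrite -subr_ge0 opprK.
have := H _ (lipN lf).
have NE nu : finite_first_moment nu -> \int[nu]_x (\- f) x = - \int[nu]_x f x.
  move=> mn; rewrite -mulN1r -(RintegralZl _ _ (lip_integrable mn lf))//.
  by apply: eq_Rintegral => x _ /=; rewrite mulN1r.
rewrite !NE//; lra.
Qed.

Definition pot eta k := \int[eta]_x put k x.

Definition mass eta := fine (eta setT).

Lemma massE eta : eta setT = (mass eta)%:E.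
Proof. by rewrite fineK// fin_num_measure. Qed.

Lemma integral_cstE eta c : \int[eta]_x c = c * mass eta.
Proof. exact: Rintegral_cst. Qed.

Lemma pot_ge0 eta k : 0 <= pot eta k.
Proof. by apply: Rintegral_ge0 => x _; rewrite le_max lexx orbT. Qed.

Definition distr_fun eta x := fine (eta `]-oo, x]%classic).

(** Pointwise, the indicator of [x <= a] is a subgradient at [a] of [k |-> put k x]; integrate in
    [x]. *)
Lemma pot_subgradient eta : finite_first_moment eta ->
  subgradient (distr_fun eta) (pot eta).
Proof.
move=> m1 a b.
have mI : measurable (`]-oo, a]%classic : set (measurableTypeR R)) by [].
rewrite /pot -(RintegralB _ (lip_integrable m1 (put_lip b)) (lip_integrable m1 (put_lip a)))//.
have -> : distr_fun eta a * (b - a) = \int[eta]_x ((b - a) * \1_(`]-oo, a]%classic) x).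
  rewrite RintegralZl//; last exact: integrable_indic.
  by rewrite mulrC /Rintegral integral_indic// setIT.
apply: le_Rintegral => //.
- have := @integrableZl _ _ _ eta setT measurableT (b - a) _ (integrable_indic eta mI).
  by [].
- exact: integrableB (lip_integrable m1 (put_lip b)) (lip_integrable m1 (put_lip a)).
move=> x _; rewrite indicE /put; case: (leP x a) => xa.
  rewrite mem_set/= ?in_itv//= mulr1.
  by rewrite (max_idPl (_ : 0 <= a - x)) ?subr_ge0// -subr_ge0; case: (leP (b - x) 0); lra.
rewrite memNset; last by rewrite /= in_itv/= leNgt xa.
rewrite mulr0 (max_idPr (_ : a - x <= 0)) ?subr_le0 ?(ltW xa)//.
by rewrite subr0 le_max lexx orbT.
Qed.

End lipschitz_integrals.

(** * Piecewise linear interpolation and the bound of [W1] by variations of potentials *)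

Section piecewise_linear_approximation.
Variable R : realType.
Implicit Types (f g : R -> R) (eta chi : finite_borel R) (x : nat -> R).

(* The opposite of the slope, so that it is nonnegative for nonincreasing [f]. *)
Definition slope f x i := (f (x i) - f (x i.+1)) / (x i.+1 - x i).

(** The interpolation of [f] at the nodes [x 0, ..., x n], constant outside them. It is written with
    differences of [put], so that its integral only involves [mass] and [pot]. *)
Fixpoint pl f x n (t : R) : R :=
  if n is m.+1 then
    pl f x m t + ((f (x m.+1) - f (x m)) + slope f x m * (put (x m.+1) t - put (x m) t))
  else f (x 0%N).

Lemma slope_mul f x n : x n < x n.+1 ->
  slope f x n * (x n.+1 - x n) = f (x n) - f (x n.+1).
Proof. by move=> xn; rewrite divfK// subr_eq0 gt_eqF. Qed.

Lemma pl_le f x n t : (forall i, x i < x i.+1) -> t <= x 0%N ->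
  pl f x n t = f (x 0%N).
Proof.
move=> xi tx0; have txi i : t <= x i.
  by elim: i => // i IH; rewrite (le_trans IH)// ltW.
elim: n => //= n ->; rewrite /put !(max_idPl _) ?subr_ge0//.
by have := slope_mul f (xi n); lra.
Qed.

Lemma pl_ge f x n t : (forall i, x i < x i.+1) -> x n <= t ->
  pl f x n t = f (x n).
Proof.
move=> xi; elim: n => //= n IH xt.
have xt' : x n <= t by rewrite (le_trans _ xt)// ltW.
by rewrite IH// /put !(max_idPr _) ?subr_le0// subr0 mulr0; lra.
Qed.

Lemma slope_norm_le f x L n : (forall i, x i < x i.+1) -> lip L f ->
  `|slope f x n| <= L.
Proof.
move=> xi lf; rewrite /slope normrM normfV ler_pdivrMr.
  by rewrite -(distrC (x n)).
by rewrite normr_gt0 gt_eqF// subr_gt0.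
Qed.

Lemma pl_near f x L d n t : (forall i, x i < x i.+1) ->
  (forall i, x i.+1 - x i <= d) -> lip L f -> 0 <= L ->
  x 0%N <= t <= x n -> `|pl f x n t - f t| <= 2 * L * d.
Proof.
move=> xi xd lf L0 /andP[x0t].
have d0 : 0 <= d by apply: le_trans (xd 0%N); rewrite subr_ge0 ltW.
elim: n => [|n IH] txn.
  have -> : t = x 0%N by apply/eqP; rewrite eq_le txn.
  by rewrite subrr normr0 !mulr_ge0.
have [tx|xt] := leP t (x n); rewrite [pl _ _ _ _]/=.
  suff -> : (f (x n.+1) - f (x n)) + slope f x n * (put (x n.+1) t - put (x n) t) = 0.
    by rewrite addr0 IH.
  rewrite /put !(max_idPl _) ?subr_ge0//.
  by have := slope_mul f (xi n); lra.
rewrite (pl_ge _ xi (ltW xt)) /put (max_idPl _) ?subr_ge0// (max_idPr _) ?subr_le0 ?(ltW xt)//.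
rewrite subr0.
have -> : f (x n) + (f (x n.+1) - f (x n) + slope f x n * (x n.+1 - t)) - f t =
  (f (x n.+1) - f t) + slope f x n * (x n.+1 - t) by lra.
apply: le_trans (ler_normD _ _) _.
have h1 := lf (x n.+1) t.
have td : `|x n.+1 - t| <= d by rewrite ger0_norm ?subr_ge0//; have := xd n; lra.
rewrite normrM; have := slope_norm_le n xi lf => h2.
have h3 := ler_wpM2r (normr_ge0 (x n.+1 - t)) h2.
have h4 := ler_wpM2l L0 td.
lra.
Qed.

Lemma pl_lip f x n : exists L, lip L (pl f x n).
Proof.
elim: n => [|n [L IH]] /=; first by exists 0; exact: lip_cst.
exists (L + (0 + `|slope f x n| * (1 + 1))).
apply: lipD IH _; apply: lipD; first exact: lip_cst.
by apply: lipZ; apply: lipD; [exact: put_lip|apply: lipN; exact: put_lip].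
Qed.

Lemma integral_plS eta f x n : finite_first_moment eta ->
  \int[eta]_t pl f x n.+1 t = \int[eta]_t pl f x n t +
    ((f (x n.+1) - f (x n)) * mass eta +
     slope f x n * (pot eta (x n.+1) - pot eta (x n))).
Proof.
move=> m1; have [L lpl] := pl_lip f x n.
have lput := lipD (put_lip (x n.+1)) (lipN (put_lip (x n))).
have lc := lip_cst (f (x n.+1) - f (x n)).
have ls := lipZ (slope f x n) lput.
rewrite /= (RintegralD _ (lip_integrable m1 lpl) (lip_integrable m1 (lipD lc ls)))//.
rewrite (RintegralD _ (lip_integrable m1 lc) (lip_integrable m1 ls))//.
rewrite integral_cstE (RintegralZl _ _ (lip_integrable m1 lput))//.
by rewrite (RintegralB _ (lip_integrable m1 (put_lip _)) (lip_integrable m1 (put_lip _))).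
Qed.

Lemma integral_pl_diff eta chi f x n :
  finite_first_moment eta -> finite_first_moment chi -> mass eta = mass chi ->
  \int[eta]_t pl f x n.+1 t - \int[chi]_t pl f x n.+1 t =
  (\int[eta]_t pl f x n t - \int[chi]_t pl f x n t) +
  slope f x n * ((pot eta (x n.+1) - pot chi (x n.+1)) - (pot eta (x n) - pot chi (x n))).
Proof. by move=> me mc E; rewrite !integral_plS// E; ring. Qed.

Lemma integral_pl0_diff eta chi f x : mass eta = mass chi ->
  \int[eta]_t pl f x 0 t - \int[chi]_t pl f x 0 t = 0.
Proof. by move=> E; rewrite !integral_cstE E subrr. Qed.

(** Mesh [1 / (n + 1)] starting at [- (n + 1)]; the point [n + 1] is reached after [2 * (n + 1) ^ 2]
    steps. *)
Definition grid n i : R := i%:R / n.+1%:R - n.+1%:R.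

Lemma grid_lt n i : grid n i < grid n i.+1.
Proof. by rewrite ltrD2r ltr_pM2r ?invr_gt0// ltr_nat. Qed.

Lemma grid_step n i : grid n i.+1 - grid n i = n.+1%:R^-1.
Proof. by rewrite /grid opprD addrACA subrr addr0 -mulrBl -natrB// subSnn mul1r. Qed.

Lemma grid0 n : grid n 0 = - n.+1%:R.
Proof. by rewrite /grid mul0r add0r. Qed.

Lemma grid_last n : grid n (2 * n.+1 * n.+1) = n.+1%:R.
Proof. by rewrite /grid !natrM mulfK ?pnatr_eq0// mulrDl mul1r addrK. Qed.

Definition pl_grid f n := pl f (grid n) (2 * n.+1 * n.+1).

Lemma pl_grid_near f L n t : lip L f -> 0 <= L -> `|t| <= n.+1%:R ->
  `|pl_grid f n t - f t| <= 2 * L / n.+1%:R.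
Proof.
move=> lf L0; rewrite ler_norml => tn; apply: pl_near => //.
- exact: grid_lt.
- by move=> i; rewrite grid_step.
- by rewrite grid0 grid_last.
Qed.

(** The dominating function, uniform in [n]. Beyond the grid, [pl_grid] takes the value of [f] at an
    end point, whose absolute value is smaller than that of [t]. *)
Lemma pl_grid_norm_le f L n t : lip L f -> 0 <= L ->
  `|pl_grid f n t| <= (`|f 0| + 2 * L) + L * `|t|.
Proof.
move=> lf L0; have [tn|] := leP (`|t|) n.+1%:R.
  have -> : pl_grid f n t = f t + (pl_grid f n t - f t) by lra.
  apply: le_trans (ler_normD _ _) _.
  have h1 := pl_grid_near lf L0 tn; have h2 := lip_norm_le t lf.
  have h3 : 2 * L / n.+1%:R <= 2 * L.
    by rewrite ler_piMr ?mulr_ge0// invf_le1// ler1n.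
  have := lerD h2 (le_trans h1 h3); set u := `|_ - f t|; lra.
have edge s : `|s| <= `|t| -> `|f s| <= (`|f 0| + 2 * L) + L * `|t|.
  move=> st; have h2 := lip_norm_le s lf; have := ler_wpM2l L0 st; lra.
rewrite ltr_normr => /orP[nt|nt].
  rewrite /pl_grid pl_ge ?grid_last ?(ltW nt)//; last exact: grid_lt.
  by apply: edge; rewrite ger0_norm// (le_trans (ltW nt))// ler_norm.
rewrite /pl_grid pl_le ?grid0; [|exact: grid_lt|by rewrite lerNr ltW].
by apply: edge; rewrite normrN ger0_norm// (le_trans (ltW nt))// -normrN ler_norm.
Qed.

Lemma pl_grid_cvg f L t : lip L f -> 0 <= L -> pl_grid f n t @[n --> \oo] --> f t.
Proof.
move=> lf L0; apply/cvgrPdist_le => e e0; near=> n.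
rewrite distrC; apply: le_trans (pl_grid_near lf L0 _) _.
  near: n; exists (Num.bound t) => // n /= tn.
  apply: ltW; apply: lt_le_trans (unstable.ltr_norm_bound t) _.
  by rewrite ler_nat (leq_trans tn).
rewrite ler_pdivrMr// [e * _]mulrC -ler_pdivrMr//; near: n => /=.
exists (Num.bound (2 * L / e)) => // n /= ln.
apply: ltW; apply: lt_le_trans (unstable.ltr_bound _) _.
by rewrite ler_nat (leq_trans ln).
Unshelve. all: by end_near. Qed.

Lemma integral_pl_grid_cvg eta f L : finite_first_moment eta -> lip L f -> 0 <= L ->
  \int[eta]_t pl_grid f n t @[n --> \oo] --> \int[eta]_t f t.
Proof.
move=> m1 lf L0.
have : (\int[eta]_t (pl_grid f n t)%:E @[n --> \oo] --> \int[eta]_t (f t)%:E)%E.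
  have [] // := @dominated_convergence _ _ _ eta setT measurableT
    (fun n t => (pl_grid f n t)%:E) (fun t => (f t)%:E)
    (fun t => (((`|f 0| + 2 * L) + L * `|t : R|)%:E)).
  - by move=> n; have [M lM] := pl_lip f (grid n) (2 * n.+1 * n.+1);
      apply/measurable_EFinP; exact: lip_measurable lM.
  - by apply/measurable_EFinP; exact: lip_measurable lf.
  - by apply: aeW => t _; apply/cvg_EFin; [exact: nearW|exact: pl_grid_cvg lf L0].
  - exact: integrable_affine_norm.
  - by apply: aeW => t n _; rewrite lee_fin; exact: pl_grid_norm_le.
rewrite (lip_integralE m1 lf) => /fine_cvg; exact.
Qed.

(** For an interpolated test function the difference of integrals is a sum of slopes times
    increments of [a - b]. Slopes are at most 1 in absolute value, so the sum is bounded by the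
    telescoping increments of [a + b]. *)
Lemma pot_diff_W1 eta chi (a b : R -> R) B :
  finite_first_moment eta -> finite_first_moment chi -> mass eta = mass chi ->
  {homo a : x y / x <= y} -> {homo b : x y / x <= y} ->
  (forall k, 0 <= a k) -> (forall k, 0 <= b k) ->
  (forall k, a k + b k <= B) ->
  (forall k, pot eta k - pot chi k = a k - b k) ->
  (W1 eta chi <= B%:E)%E.
Proof.
move=> me mc E nda ndb a0 b0 abB potE; apply: W1_le => // f lf.
have cv : \int[eta]_t pl_grid f n t - \int[chi]_t pl_grid f n t @[n --> \oo]
    --> \int[eta]_t f t - \int[chi]_t f t.
  by apply: cvgB; exact: integral_pl_grid_cvg lf _.
rewrite -(cvg_lim _ cv)//; apply: limr_le; first by apply: cvgP cv.
apply: nearW => n; rewrite /pl_grid; set N := (_ * _)%N.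
suff : \int[eta]_t pl f (grid n) N t - \int[chi]_t pl f (grid n) N t
    <= a (grid n N) + b (grid n N) - (a (grid n 0) + b (grid n 0)).
  move=> h /=; apply: le_trans h _; apply: le_trans (abB (grid n N)).
  by rewrite gerBl addr_ge0.
elim: N => [|N IH]; first by rewrite integral_pl0_diff// subrr.
rewrite integral_pl_diff// !potE.
have := slope_norm_le N (grid_lt n) lf.
have da := nda _ _ (ltW (grid_lt n N)).
have db := ndb _ _ (ltW (grid_lt n N)).
set s := slope _ _ _; rewrite ler_norml => /andP[s1 s2].
have h1 : s * (a (grid n N.+1) - a (grid n N)) <= 1 * (a (grid n N.+1) - a (grid n N)).
  by rewrite ler_wpM2r// subr_ge0.
have h2 : - s * (b (grid n N.+1) - b (grid n N)) <= 1 * (b (grid n N.+1) - b (grid n N)).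
  by rewrite ler_wpM2r ?subr_ge0//; lra.
lra.
Qed.

End piecewise_linear_approximation.

(** * The decreasing convex order in terms of potentials *)

Section convex_order.
Variable R : realType.
Implicit Types (f g : R -> R) (eta chi : finite_borel R).

Lemma ordered_lip L f :
  (forall x y, x <= y -> `|f x - f y| <= L * (y - x)) -> lip L f.
Proof.
move=> H x y; have [xy|/ltW yx] := leP x y.
  by rewrite (distrC x) (ger0_norm (_ : 0 <= y - x)) ?subr_ge0 ?H.
by rewrite distrC (ger0_norm (_ : 0 <= x - y)) ?subr_ge0 ?H.
Qed.

Lemma increment_bounds_glue (lo hi : R) k f :
  (forall x y, x <= y -> y <= k -> lo * (y - x) <= f x - f y <= hi * (y - x)) ->
  (forall x y, k <= x -> x <= y -> lo * (y - x) <= f x - f y <= hi * (y - x)) ->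
  forall x y, x <= y -> lo * (y - x) <= f x - f y <= hi * (y - x).
Proof.
move=> fl fr x y xy; have [yk|/ltW ky] := leP y k; first exact: fl.
have [kx|/ltW xk] := leP k x; first exact: fr.
have := fl _ _ xk (lexx k); have := fr _ _ (lexx k) ky; lra.
Qed.

Lemma put_le (k x : R) : x <= k -> put k x = k - x.
Proof. by move=> xk; rewrite /put (max_idPl _)// subr_ge0. Qed.

Lemma put_ge (k x : R) : k <= x -> put k x = 0.
Proof. by move=> kx; rewrite /put (max_idPr _)// subr_le0. Qed.

(** Functions with derivative [- w], [0 <= w <= 1], to the left of [k]: integrating one against
    [eta - chi] gives the integral over []-oo, k]] of [w] times the difference of the distribution
    functions. *)
Definition decreasing_test k : set (R -> R) := [set phi |
  [/\ forall x y, x <= y -> 0 <= phi x - phi y <= y - x &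
      forall x, k <= x -> phi x = 0]].

Lemma decreasing_test_lip k phi : decreasing_test k phi -> lip 1 phi.
Proof.
move=> [H _]; apply: ordered_lip => x y /H /andP[h1 h2].
by rewrite mul1r ger0_norm.
Qed.

Lemma put_decreasing_test k : decreasing_test k (put k).
Proof.
split=> [x y xy|x]; last exact: put_ge.
have := @increment_bounds_glue 0 1 k (put k) _ _ x y xy.
rewrite mul0r mul1r; apply=> u v.
  by move=> uv vk; rewrite !put_le ?(le_trans uv)//; lra.
by move=> ku uv; rewrite !put_ge ?(le_trans ku)//; lra.
Qed.

Lemma integralB_lip eta L M f g : finite_first_moment eta -> lip L f -> lip M g ->
  \int[eta]_x (f x - g x) = \int[eta]_x f x - \int[eta]_x g x.
Proof.
by move=> m1 lf lg; rewrite (RintegralB _ (lip_integrable m1 lf) (lip_integrable m1 lg)).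
Qed.

Lemma integralD_lip eta L M f g : finite_first_moment eta -> lip L f -> lip M g ->
  \int[eta]_x (f x + g x) = \int[eta]_x f x + \int[eta]_x g x.
Proof.
by move=> m1 lf lg; rewrite (RintegralD _ (lip_integrable m1 lf) (lip_integrable m1 lg)).
Qed.

(* [a k] is the integral over ]-oo, k] of the positive part of the difference
   of the distribution functions, written in dual form so that it directly
   compares with [W1]. *)
Lemma pot_diff_decomposition eta chi B :
  finite_first_moment eta -> finite_first_moment chi -> (W1 eta chi <= B%:E)%E ->
  exists a b : R -> R, [/\ {homo a : x y / x <= y} /\ {homo b : x y / x <= y},
    (forall k, 0 <= a k) /\ (forall k, 0 <= b k),
    (forall k, a k + b k <= B) &
    (forall k, pot eta k - pot chi k = a k - b k)].
Proof.
move=> me mc WB.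
pose J f := \int[eta]_x f x - \int[chi]_x f x.
have JD f g : lip 1 f -> lip 1 g -> J (fun x => f x + g x) = J f + J g.
  by move=> lf lg; rewrite /J !(integralD_lip _ lf lg)//; lra.
have JB f g L M : lip L f -> lip M g -> J (fun x => f x - g x) = J f - J g.
  by move=> lf lg; rewrite /J !(integralB_lip _ lf lg)//; lra.
have JW f : lip 1 f -> J f <= B by exact: W1_ge.
pose a k := sup [set J phi | phi in decreasing_test k].
have a_ub k phi : decreasing_test k phi -> J phi <= a k.
  move=> t; apply: ub_le_sup; last by exists phi.
  by exists B => _ [psi /decreasing_test_lip /JW psiB <-].
have a_le k c : (forall phi, decreasing_test k phi -> J phi <= c) -> a k <= c.
  move=> H; apply: ge_sup; first by exists (J (put k)), (put k) => //; exact: put_decreasing_test.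
  by move=> _ [phi tphi <-]; exact: H.
exists a, (fun k => a k - (pot eta k - pot chi k)); split.
- split=> k l kl.
    apply: a_le => phi [p1 p2]; apply: a_ub; split=> // x lx.
    by rewrite p2// (le_trans kl).
  (* Monotonicity of the second function: adding [put l - put k] to a test for [k] gives a test for
     [l], since this difference is constant left of [k], where alone [phi] varies. *)
  rewrite lerBlDr; apply: a_le => phi tphi.
  have := decreasing_test_lip tphi => lphi.
  have E : J (fun x => phi x + (put l x - put k x)) =
      J phi + (pot eta l - pot chi l) - (pot eta k - pot chi k).
    have l2 : lip 1 (fun x => put l x - put k x).
      apply: ordered_lip => x y xy; rewrite mul1r ler_norml.
      have := @increment_bounds_glue 0 1 k (fun x => put l x - put k x) _ _ x y xy.
      rewrite mul0r mul1r => H.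
      suff : 0 <= (put l x - put k x) - (put l y - put k y) <= y - x by lra.
      apply: H => u v.
        move=> uv vk; rewrite !put_le ?(le_trans uv)//; first lra.
        - by rewrite (le_trans vk).
        - by rewrite (le_trans vk).
      move=> ku uv; rewrite !(@put_ge k) ?(le_trans ku)// !subr0 mul0r mul1r.
      by case: (put_decreasing_test l) => + _; apply.
    by rewrite JD// (JB _ _ _ _ (put_lip l) (put_lip k)) /J /pot; lra.
  suff : decreasing_test l (fun x => phi x + (put l x - put k x)).
    by move=> /a_ub; rewrite E; lra.
  case: tphi => p1 p2; split=> [x y xy|x lx]; last first.
    by rewrite p2 ?(le_trans kl)// !put_ge ?(le_trans kl)// subrr addr0.
  have := @increment_bounds_glue 0 1 k (fun x => phi x + (put l x - put k x)) _ _ x y xy.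
  rewrite mul0r mul1r; apply=> u v.
    move=> uv vk; have := p1 u v uv.
    by rewrite !(@put_le k) ?(le_trans uv)// !put_le ?(le_trans vk)//
      ?(le_trans uv) ?(le_trans vk)//; lra.
  move=> ku uv; rewrite !(@put_ge k) ?(le_trans ku)// !p2 ?(le_trans ku)//.
  rewrite !add0r !subr0 mul0r mul1r.
  by case: (put_decreasing_test l) => + _; apply.
- split=> k.
    apply: le_trans (a_ub k (fun=> 0) _); last by split=> // x y; rewrite subrr subr_ge0 lexx.
    by rewrite /J !integral_cstE !mul0r subrr.
  by rewrite subr_ge0; apply: a_ub; exact: put_decreasing_test.
(* Left of [k] the slope of [2 * phi - put k] is twice a number in [[-1, 0]] plus 1, so this
   function is 1-Lipschitz and [J] of it is at most [B]. *)
- move=> k; suff : a k <= (B + (pot eta k - pot chi k)) / 2 by lra.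
  apply: a_le => phi tphi; have lphi := decreasing_test_lip tphi.
  have E : J (fun x => phi x + (phi x - put k x)) = J phi * 2 - (pot eta k - pot chi k).
    have l2 : lip 1 (fun x => phi x - put k x).
      case: tphi => p1 p2; apply: ordered_lip => x y xy; rewrite mul1r ler_norml.
      by have := p1 x y xy; have [/(_ x y xy)] := put_decreasing_test k; lra.
    by rewrite JD// (JB _ _ _ _ lphi (put_lip k)) /J /pot; lra.
  suff : lip 1 (fun x => phi x + (phi x - put k x)) by move=> /JW; rewrite E; lra.
  case: tphi => p1 p2; apply: ordered_lip => x y xy; rewrite mul1r ler_norml.
  have := @increment_bounds_glue (-1) 1 k (fun x => phi x + (phi x - put k x)) _ _ x y xy.
  rewrite mulN1r mul1r; apply=> u v.
    by move=> uv vk; have := p1 u v uv; rewrite !put_le ?(le_trans uv)//; lra.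
  by move=> ku uv; rewrite !put_ge ?(le_trans ku)// !p2 ?(le_trans ku)//; lra.
- by move=> k; lra.
Qed.

Lemma convex_nonincreasing_cst (c : R) : convex_nonincreasing (fun=> c).
Proof.
split=> [t x y _ _|x y _]; last exact: lexx.
by rewrite convRE -mulrDl addrC subrK mul1r.
Qed.

Lemma convex_nonincreasing_put (k : R) : convex_nonincreasing (put k).
Proof.
split=> [t x y _ _|x y yx]; last first.
  by rewrite /put ge_max !le_max lexx orbT andbT lerD2l lerN2 yx.
have t0 : 0 <= t%:inum by exact: ge0.
have t1 : 0 <= 1 - t%:inum by rewrite subr_ge0; exact: le1.
change (Num.max (k - (t%:inum * (x : R) + (1 - t%:inum) * (y : R))) 0 <=
  t%:inum * Num.max (k - x) 0 + (1 - t%:inum) * Num.max (k - y) 0).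
rewrite ge_max; apply/andP; split.
  have -> : k - (t%:inum * (x : R) + (1 - t%:inum) * (y : R)) =
    t%:inum * (k - x) + (1 - t%:inum) * (k - y) by ring.
  by rewrite lerD// ler_wpM2l// le_max lexx.
by rewrite addr_ge0// mulr_ge0// le_max lexx orbT.
Qed.

Lemma convex_nonincreasing_cvx f : convex_nonincreasing f -> cvx f.
Proof.
move=> [cf _] x z y xz zy.
have [->|xy] := eqVneq x y; first by lra.
have xy' : 0 < y - x by rewrite subr_gt0 lt_neqAle xy (le_trans xz).
have t0 : 0 <= (y - z) / (y - x) by rewrite divr_ge0 ?subr_ge0// (le_trans xz).
have t1 : (y - z) / (y - x) <= 1 by rewrite ler_pdivrMr// mul1r lerD2l lerN2.
set t := _ / _ in t0 t1.
have tE : t * (y - x) = y - z by rewrite divfK// gt_eqF.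
have H : f (t * x + (1 - t) * y) <= t * f x + (1 - t) * f y.
  exact: (cf (Itv01 t0 t1) x y (mem_set Logic.I) (mem_set Logic.I)).
have {}H := ler_wpM2l (ltW xy') H.
have zE : t * x + (1 - t) * y = z by lra.
rewrite zE in H.
apply: le_trans H _; rewrite le_eqVlt; apply/orP; left; apply/eqP.
have -> : z - x = (y - x) - t * (y - x) by lra.
by rewrite -tE; ring.
Qed.

Lemma pcd_le_pot eta chi : finite_first_moment eta -> finite_first_moment chi ->
  pcd_le eta chi -> forall k, pot eta k <= pot chi k.
Proof.
move=> me mc H k; have lp := put_lip k.
have := H _ (convex_nonincreasing_put k).
rewrite !(lip_integralE _ lp)// lee_fin; apply => x.
by rewrite le_max lexx orbT.
Qed.

Lemma cd_le_pcd eta chi : cd_le eta chi -> pcd_le eta chi.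
Proof. by move=> H f cf _; exact: H. Qed.

(** The constants 1 and -1 are both admissible test functions. *)
Lemma cd_le_mass eta chi : cd_le eta chi -> mass eta = mass chi.
Proof.
move=> H; apply/eqP; rewrite eq_le.
have := H _ (convex_nonincreasing_cst 1); have := H _ (convex_nonincreasing_cst (-1)).
have E nu (c : R) : (\int[nu : finite_borel R]_x c%:E = (c * mass nu)%:E)%E.
  by rewrite EFinM -massE integral_cst.
by rewrite !E !lee_fin !mulN1r !mul1r lerN2 => -> ->.
Qed.

Lemma pot_cvg0 eta : finite_first_moment eta ->
  pot eta (- n.+1%:R) @[n --> \oo] --> 0.
Proof.
move=> m1.
have : (\int[eta]_t (put (- n.+1%:R) t)%:E @[n --> \oo] --> \int[eta]_t 0%:E)%E.
  have [] // := @dominated_convergence _ _ _ eta setT measurableT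
    (fun n t => (put (- n.+1%:R) t)%:E) (fun t => 0%:E)
    (fun t => (0 + 1 * `|t : R|)%:E).
  - by move=> n; apply/measurable_EFinP; apply: lip_measurable; exact: put_lip.
  - apply: aeW => t _; apply: cvg_near_cst; near=> n.
    congr EFin; rewrite /put (max_idPr _)// subr_le0.
    rewrite lerNl; apply: (@le_trans _ _ n%:R); last by rewrite ler_nat.
    apply: ltW; near: n; exists (Num.bound t) => // n /= tn.
    apply: lt_le_trans (unstable.ltrNbound t) _.
    by rewrite ler_nat.
  - exact: integrable_affine_norm.
  - apply: aeW => t n _; rewrite lee_fin add0r mul1r ger0_norm ?le_max ?lexx ?orbT//.
    rewrite ge_max normr_ge0 andbT; apply: le_trans (_ : - t <= _).
      by rewrite gerDr oppr_le0.
    by rewrite -normrN ler_norm.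
rewrite integral0 => /fine_cvg; exact.
Unshelve. all: by end_near. Qed.

(** Abel summation for the interpolations: the slopes, with sign reversed, are nonnegative and
    nonincreasing, and the difference [w] of potentials is nonnegative, so only the boundary term at
    the leftmost node can be negative. *)
Lemma le_integral_of_pot_lip eta chi f L :
  finite_first_moment eta -> finite_first_moment chi -> mass eta = mass chi ->
  (forall k, pot eta k <= pot chi k) ->
  lip L f -> cvx f -> {homo f : x y /~ x <= y} ->
  \int[eta]_x f x <= \int[chi]_x f x.
Proof.
move=> me mc E pp lf cf nif.
have L0 : 0 <= L by have := lf 1 0; rewrite subr0 normr1 mulr1; apply: le_trans.
(* The added term compensates the boundary term at the leftmost node [- (n + 1)]; it vanishes in the
   limit because potentials tend to 0 at [-oo]. *)
have cv : (\int[chi]_t pl_grid f n t - \int[eta]_t pl_grid f n t) +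
    L * (pot chi (- n.+1%:R) - pot eta (- n.+1%:R)) @[n --> \oo]
    --> (\int[chi]_t f t - \int[eta]_t f t) + L * (0 - 0).
  apply: cvgD; first by apply: cvgB; exact: integral_pl_grid_cvg lf _.
  by apply: cvgMr; apply: cvgB; exact: pot_cvg0.
rewrite -subr_ge0.
have -> : \int[chi]_x f x - \int[eta]_x f x =
  (\int[chi]_t f t - \int[eta]_t f t) + L * (0 - 0) by rewrite subrr mulr0 addr0.
rewrite -(cvg_lim _ cv)//; apply: limr_ge; first by apply: cvgP cv.
apply: nearW => n; rewrite /pl_grid; set N := (_ * _)%N; rewrite -grid0.
set x := grid R n; set w := fun k => pot chi k - pot eta k.
have xlt i : x i < x i.+1 by exact: grid_lt.
have w0 k : 0 <= w k by rewrite subr_ge0.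
have slope0 i : 0 <= slope f x i.
  by rewrite divr_ge0 ?subr_ge0 ?nif ?(ltW (xlt i)).
have slopeS i : slope f x i.+1 <= slope f x i.
  rewrite /slope ler_pdivrMr ?subr_gt0// mulrAC ler_pdivlMr ?subr_gt0//.
  have := cf _ _ _ (ltW (xlt i)) (ltW (xlt i.+1)); lra.
suff : slope f x N * w (x N) - slope f x 0 * w (x 0%N) <=
    \int[chi]_t pl f x N t - \int[eta]_t pl f x N t.
  have h1 := mulr_ge0 (slope0 N) (w0 (x N)).
  have := slope_norm_le 0 xlt lf; rewrite (ger0_norm (slope0 _)) => h2.
  have h3 := ler_wpM2r (w0 (x 0%N)) h2.
  rewrite -/(w (x 0%N)); lra.
elim: N => [|N IH]; first by rewrite integral_pl0_diff// subrr.
rewrite integral_pl_diff// -/(w _) -/(w (x N)).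
have := ler_wpM2r (w0 (x N.+1)) (slopeS N); lra.
Qed.

End convex_order.

(** * From potentials to the decreasing convex order *)

Section convex_order_criterion.
Variable R : realType.
Implicit Types (eta chi : finite_borel R).

(** The integral of [u] may be infinite. Additivity for nonnegative functions is applied to
    [F^+ + G^- = u + G^+ + F^-], where [F = u + g] and [G = g]; the negative parts have finite
    integrals. *)
Lemma integral_ge0D_integrable d (T : measurableType d)
    (mu : {measure set T -> \bar R}) (u g : T -> R) :
  measurable_fun setT u -> (forall x, 0 <= u x) ->
  mu.-integrable setT (EFin \o g) ->
  (\int[mu]_x (u x + g x)%:E = \int[mu]_x (u x)%:E + \int[mu]_x (g x)%:E)%E.
Proof.
move=> mu_ u0 ig.
have mg : measurable_fun setT g by apply/measurable_EFinP; exact: measurable_int ig.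
have mF : measurable_fun setT (EFin \o (u \+ g)).
  by apply/measurable_EFinP; exact: measurable_funD.
set F := EFin \o (u \+ g) in mF; set G := EFin \o g.
have mG : measurable_fun setT G by exact/measurable_EFinP.
have mU : measurable_fun setT (EFin \o u) by exact/measurable_EFinP.
have key : (\int[mu]_x F^\+ x + \int[mu]_x G^\- x =
    \int[mu]_x (u x)%:E + \int[mu]_x G^\+ x + \int[mu]_x F^\- x)%E.
  rewrite -!ge0_integralD//; try (by move=> x _; rewrite ?adde_ge0 ?lee_fin);
    try exact: measurable_funepos; try exact: measurable_funeneg;
    try (by apply: emeasurable_funD => //; exact: measurable_funepos).
  apply: eq_integral => x _.
  rewrite !funeposE !funenegE /F /G /= -!EFin_max -!EFinD; congr EFin.
  by case: (leP (u x + g x) 0); case: (leP (- (u x + g x)) 0);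
    case: (leP (g x) 0); case: (leP (- g x) 0); lra.
have Gm : (\int[mu]_x G^\- x)%E \is a fin_num by exact: integrable_neg_fin_num.
have Gp : (\int[mu]_x G^\+ x)%E \is a fin_num by exact: integrable_pos_fin_num.
have Fm : (\int[mu]_x F^\- x)%E \is a fin_num.
  rewrite ge0_fin_numE; last exact: integral_ge0.
  apply: le_lt_trans (_ : _ <= \int[mu]_x G^\- x)%E _; last by rewrite -ge0_fin_numE// integral_ge0.
  apply: ge0_le_integral => //; [exact: measurable_funeneg|exact: measurable_funeneg|].
  move=> x _; rewrite !funenegE /F /G /= -!EFin_max lee_fin.
  have := u0 x; rewrite ge_max !le_max lexx orbT andbT => ux.
  by apply/orP; left; lra.
have Fp0 : (0 <= \int[mu]_x F^\+ x)%E by exact: integral_ge0.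
have U0 : (0 <= \int[mu]_x (u x)%:E)%E by apply: integral_ge0 => x _; rewrite lee_fin.
have -> : (\int[mu]_x (u x + g x)%:E = \int[mu]_x F^\+ x - \int[mu]_x F^\- x)%E.
  by rewrite [LHS]integralE.
have -> : (\int[mu]_x (g x)%:E = \int[mu]_x G^\+ x - \int[mu]_x G^\- x)%E.
  by rewrite [LHS]integralE.
move: key Gm Gp Fm Fp0 U0.
move: (\int[mu]_x F^\+ x)%E (\int[mu]_x G^\- x)%E (\int[mu]_x G^\+ x)%E
  (\int[mu]_x F^\- x)%E (\int[mu]_x (u x)%:E)%E => A B C E U.
case: B => [b||]//; case: C => [c||]//; case: E => [e||]//.
case: A => [a||]//; case: U => [v||]//= [] H _ _ _ _ _.
by congr EFin; lra.
Qed.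

(** [f] is the increasing limit of suprema [fn n] of its tangents of slope at least [- K n]. These
    are Lipschitz, convex and nonincreasing, so the Lipschitz case and monotone convergence
    conclude. *)
Lemma cd_le_of_pot eta chi :
  finite_first_moment eta -> finite_first_moment chi -> mass eta = mass chi ->
  (forall k, pot eta k <= pot chi k) -> cd_le eta chi.
Proof.
move=> me mc E pp f cnf; have cf := convex_nonincreasing_cvx cnf.
have nif : {homo f : x y /~ x <= y} by case: cnf.
have := right_slope_subgradient cf; set F := right_slope f => Ff.
have F0 x : F x <= 0.
  have := Ff x (x + 1); have : f (x + 1) <= f x by apply: nif; rewrite lerDl.
  by lra.
have tangent q x : f q + F q * (x - q) <= f x by have := Ff q x; lra.
(* The shift by [F 0] admits the tangent at 0 for every [n], so that [T n x] is never empty. *)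
pose K n := n%:R - F 0.
pose T n x := [set f q + F q * (x - q) | q in [set q | - F q <= K n]].
have T0 n x : T n x !=set0 by exists (f 0 + F 0 * (x - 0)), 0 => //=; rewrite /K lerDr.
have Tub n x : ubound (T n x) (f x) by move=> _ [q _ <-].
pose fn n x := sup (T n x).
have fn_le n x : fn n x <= f x by apply: ge_sup.
have fn_ub n q x : - F q <= K n -> f q + F q * (x - q) <= fn n x.
  by move=> Fq; apply: ub_le_sup; [exists (f x)|exists q].
have fn_lub n x c : (forall q, - F q <= K n -> f q + F q * (x - q) <= c) -> fn n x <= c.
  by move=> H; apply: ge_sup => // _ [q Fq <-]; exact: H.
have fn_ni n : {homo fn n : x y /~ x <= y}.
  move=> x y yx; apply: fn_lub => q Fq; apply: le_trans (fn_ub _ _ _ Fq).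
  by rewrite lerD2l ler_wnM2l ?lerD2r.
have fn_cvx n : cvx (fn n).
  move=> x z y xz zy.
  have [->|xy] := eqVneq x y; first by lra.
  have xy' : 0 < y - x by rewrite subr_gt0 lt_neqAle xy (le_trans xz).
  rewrite mulrC -ler_pdivlMr//; apply: fn_lub => q Fq.
  rewrite ler_pdivlMr//.
  have h1 : (y - z) * (f q + F q * (x - q)) <= (y - z) * fn n x.
    by rewrite ler_wpM2l ?subr_ge0 ?fn_ub.
  have h2 : (z - x) * (f q + F q * (y - q)) <= (z - x) * fn n y.
    by rewrite ler_wpM2l ?subr_ge0 ?fn_ub.
  lra.
have K0 n : 0 <= K n by rewrite /K addr_ge0 ?oppr_ge0.
have fn_lip n : lip (K n) (fn n).
  apply: ordered_lip => x y xy; rewrite ger0_norm ?subr_ge0 ?fn_ni// lerBlDr.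
  apply: fn_lub => q Fq; have h1 := fn_ub n q y Fq.
  have h2 : - F q * (y - x) <= K n * (y - x) by rewrite ler_wpM2r ?subr_ge0.
  lra.
have fnS m n x : (m <= n)%N -> fn m x <= fn n x.
  move=> mn; apply: fn_lub => q Fq; apply: fn_ub; apply: le_trans Fq _.
  by rewrite lerD2r ler_nat.
have fn_eq x : \forall n \near \oo, fn n x = f x.
  exists (Num.bound (F 0 - F x)) => // n /= Fn.
  apply/eqP; rewrite eq_le fn_le /=.
  have := fn_ub n x x; rewrite subrr mulr0 addr0; apply.
  have : F 0 - F x < n%:R.
    by apply: lt_le_trans (unstable.ltr_bound _) _; rewrite ler_nat.
  by rewrite /K; lra.
have mf : measurable_fun setT (f : measurableTypeR R -> R).
  by apply: nonincreasing_measurable => // x y xy; exact: nif.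
have mfn n : measurable_fun setT (fn n : measurableTypeR R -> R).
  exact: lip_measurable (fn_lip n).
(* Subtracting the integrable minorant [fn 0] makes the sequence nonnegative, as monotone
   convergence demands. *)
have split_ nu (g : R -> R) : finite_first_moment nu ->
    measurable_fun setT (g : measurableTypeR R -> R) -> (forall x, fn 0 x <= g x) ->
    (\int[nu : finite_borel R]_x (g x)%:E =
     \int[nu]_x (g x - fn 0 x)%:E + \int[nu]_x (fn 0 x)%:E)%E.
  move=> mn mg g0; rewrite -integral_ge0D_integrable.
  - by apply: eq_integral => x _; rewrite subrK.
  - exact: measurable_funB.
  - by move=> x; rewrite subr_ge0.
  - exact: lip_integrable mn (fn_lip 0).
have cvfn nu : finite_first_moment nu ->
    (\int[nu : finite_borel R]_x (fn n x)%:E @[n --> \oo] --> \int[nu]_x (f x)%:E)%E.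
  move=> mn; rewrite (split_ _ _ mn mf); last by move=> x; exact: fn_le.
  under eq_cvg do rewrite (split_ _ _ mn (mfn _) (fun x => fnS _ _ x (leq0n _))).
  apply: cvgeD; last exact: cvg_cst.
    by rewrite fin_num_adde_defl// (lip_integralE mn (fn_lip 0)).
  have -> : (\int[nu]_x (f x - fn 0 x)%:E =
      \int[nu]_x (limn (fun n => (fn n x - fn 0 x)%:E)))%E.
    apply: eq_integral => x _; apply/esym/cvg_lim => //.
    apply: cvg_near_cst; near=> n; congr (_ - _)%:E; near: n; exact: fn_eq.
  apply: cvg_monotone_convergence => //.
  - by move=> n; apply/measurable_EFinP; exact: measurable_funB.
  - by move=> n x _; rewrite lee_fin subr_ge0 fnS.
  - by move=> x _ m n mn'; rewrite lee_fin lerD2r fnS.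
rewrite -(cvg_lim _ (cvfn _ me))// -(cvg_lim _ (cvfn _ mc))//.
apply: lee_lim; [exact: cvgP (cvfn _ me)|exact: cvgP (cvfn _ mc)|].
apply: nearW => n; rewrite !(lip_integralE _ (fn_lip n))// lee_fin.
exact: le_integral_of_pot_lip (fn_lip n) _ _.
Unshelve. all: by end_near. Qed.

End convex_order_criterion.

(** * Measures with a prescribed potential *)

Section measure_of_potential.
Variable R : realType.
Implicit Types (f F C : R -> R) (eta chi nu : finite_borel R).

Lemma rcont_cvg F : {homo F : x y / x <= y} -> rcont F ->
  forall x, F @ at_right x --> F x.
Proof.
move=> ndF rF x; apply/cvgrPdist_le => e /(rF x) [b xb Fb].
near=> y.
have xy : x < y by near: y; exact: nbhs_right_gt.
have yb : y < b by near: y; exact: nbhs_right_lt.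
rewrite distrC ger0_norm ?subr_ge0 ?ndF ?(ltW xy)//.
by rewrite lerBlDl (le_trans _ Fb)// ndF// ltW.
Unshelve. all: by end_near. Qed.

Lemma distr_fun_nondecreasing eta : {homo distr_fun eta : x y / x <= y}.
Proof.
move=> x y xy; rewrite /distr_fun fine_le ?fin_num_measure//.
by rewrite le_measure ?inE//; exact: subitvPr.
Qed.

Lemma distr_fun_ge0 eta x : 0 <= distr_fun eta x.
Proof. by rewrite fine_ge0. Qed.

Lemma distr_funE eta x : eta `]-oo, x]%classic = (distr_fun eta x)%:E.
Proof. by rewrite fineK// fin_num_measure. Qed.

Lemma measure_oc eta a b : a <= b ->
  eta `]a, b]%classic = (distr_fun eta b - distr_fun eta a)%:E.
Proof.
move=> ab; rewrite EFinB -!distr_funE.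
have -> : `]-oo, b]%classic = `]-oo, a]%classic `|` `]a, b]%classic :> set R.
  by rewrite -itv_bndbnd_setU// bnd_simp.
rewrite measureU//; last first.
  apply/seteqP; split=> // x [] /=; rewrite !in_itv/= => xa /andP[].
  by rewrite ltNge xa.
by rewrite addeAC subee ?add0e// fin_num_measure.
Qed.

Lemma distr_fun_rcont eta : rcont (distr_fun eta).
Proof.
move=> a e e0.
pose I n : set (measurableTypeR R) := `]-oo, (a + n.+1%:R^-1)%R]%classic.
have : eta (I n) @[n --> \oo] --> eta (\bigcap_n I n).
  apply: nonincreasing_cvg_mu => [| | |m n mn].
  - by rewrite -ge0_fin_numE// fin_num_measure//; exact: measurable_itv.
  - by move=> n; exact: measurable_itv.
  - by apply: bigcap_measurable => // n _; exact: measurable_itv.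
  - apply/subsetPset; apply: subset_itvl.
    by rewrite bnd_simp lerD2l lef_pV2 ?posrE// ler_nat.
rewrite /I -itvNycEbigcap distr_funE => /fine_cvg /= cv.
have /cvgrPdist_le/(_ _ e0) [n _ /(_ n (leqnn n))/=] := cv.
move=> H; exists (a + n.+1%:R^-1); first by rewrite ltrDl.
by move: H; rewrite distrC => H; rewrite -lerBlDl; apply: le_trans (ler_norm _) H.
Qed.

Lemma pot_nondecreasing eta : finite_first_moment eta ->
  {homo pot eta : x y / x <= y}.
Proof.
move=> m1 x y xy; rewrite -subr_ge0; apply: le_trans (pot_subgradient m1 x y).
by rewrite mulr_ge0 ?subr_ge0// distr_fun_ge0.
Qed.

Lemma pot_small eta e x : finite_first_moment eta -> 0 < e ->
  exists2 y, y <= x & pot eta y <= e.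
Proof.
move=> m1 e0; have /cvgrPdist_le/(_ _ e0) [n _ nP] := pot_cvg0 m1.
have := nP _ (leq_maxl n (Num.bound x)); set m := maxn _ _ => /= H.
exists (- m.+1%:R).
  rewrite lerNl; apply: ltW; apply: lt_le_trans (unstable.ltrNbound x) _.
  by rewrite ler_nat (leq_trans (leq_maxr n _)).
by move: H; rewrite distrC subr0; apply: le_trans; exact: ler_norm.
Qed.

Lemma distr_fun_small eta e x : finite_first_moment eta -> 0 < e ->
  exists2 y, y <= x & distr_fun eta y <= e.
Proof.
move=> m1 e0; have [y yx ye] := pot_small x m1 e0.
exists (y - 1); first by lra.
have := pot_subgradient m1 (y - 1) y; have := pot_ge0 eta (y - 1); lra.
Qed.

Lemma subgradient_ge0 F f M x : subgradient F f -> (forall y, 0 <= f y) ->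
  (forall y, y <= x -> f y <= M) -> 0 <= F x.
Proof.
move=> Ff f0 fM; rewrite leNgt; apply/negP => Fx.
have F0 : F x != 0 by rewrite lt_eqF.
(* If [F x < 0], this point lies left of [x], and there the tangent at [x] has risen by [M + 1],
   above the bound [M]. *)
have := Ff x (x + (M + 1) / F x).
have -> : F x * (x + (M + 1) / F x - x) = M + 1.
  by rewrite [x + _]addrC addrK mulrC divfK.
have M0 : 0 <= M by apply: le_trans (f0 x) (fM x _).
have := f0 x; have /fM : x + (M + 1) / F x <= x.
  by rewrite gerDl mulr_ge0_le0 ?invr_le0 ?(ltW Fx)//; lra.
lra.
Qed.

Lemma rcont_cumulative F : {homo F : x y / x <= y} -> rcont F ->
  exists G : cumulative R R, (G : R -> R) = F.
Proof.
move=> ndF rF.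
pose m := isCumulative.Build R _ R F ndF (rcont_cvg ndF rF).
pose G : cumulative R R := HB.pack F m.
by exists G.
Qed.

Lemma lebesgue_stieltjes_oc (G : cumulative R R) a b : a <= b ->
  lebesgue_stieltjes_measure G `]a, b]%classic = (G b - G a)%:E.
Proof.
move=> ab; rewrite /lebesgue_stieltjes_measure /measure_extension.
by rewrite measurable_mu_extE/= ?wlength_itv_bnd//; exact: is_ocitv.
Qed.

Lemma ocitv_cases (X : set (ocitv_type R)) : ocitv X ->
  X = set0 \/ exists a b : R, a <= b /\ X = `]a, b]%classic.
Proof.
move=> /ocitvP[->|[[a b] /= ab ->]]; [by left|right].
by exists a, b; split => //; exact: ltW.
Qed.

Lemma measure_of_distribution F : {homo F : x y / x <= y} -> rcont F ->
  exists theta : {measure set (measurableTypeR R) -> \bar R},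
    forall a b, a <= b -> theta `]a, b]%classic = (F b - F a)%:E.
Proof.
move=> ndF rF; have [G GE] := rcont_cumulative ndF rF.
exists (lebesgue_stieltjes_measure G) => a b ab.
by apply: etrans (lebesgue_stieltjes_oc G ab) _; rewrite GE.
Qed.

Lemma measure_unique_oc nu (theta : {measure set (measurableTypeR R) -> \bar R}) :
  (forall a b, a <= b ->
    theta `]a, b]%classic = (distr_fun nu b - distr_fun nu a)%:E) ->
  forall A, measurable A -> nu A = theta A.
Proof.
move=> oc A mA.
have [G GE] := rcont_cumulative (@distr_fun_nondecreasing nu) (@distr_fun_rcont nu).
rewrite -(@lebesgue_stieltjes_measure_unique R G nu _ A mA); last first.
  move=> X /ocitv_cases[->|[a [b [ab ->]]]]; first by rewrite !measure0.
  by apply: etrans (lebesgue_stieltjes_oc G ab) _; rewrite GE; apply/esym/measure_oc.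
apply: (@lebesgue_stieltjes_measure_unique R G theta) => // X.
move=> /ocitv_cases[->|[a [b [ab ->]]]]; first by rewrite !measure0.
by apply: etrans (lebesgue_stieltjes_oc G ab) _; rewrite GE; apply/esym/oc.
Qed.

(** The remainder [rho] is the Lebesgue-Stieltjes measure of [distr_fun nu - F]; both sides then
    agree on half-open intervals, hence on all Borel sets. *)
Lemma measure_add_distr nu F (theta : {measure set (measurableTypeR R) -> \bar R}) :
  {homo (distr_fun nu \- F) : x y / x <= y} -> rcont (distr_fun nu \- F) ->
  (forall a b, a <= b -> theta `]a, b]%classic = (F b - F a)%:E) ->
  exists rho : {measure set (measurableTypeR R) -> \bar R},
    forall A, measurable A -> nu A = measure_add theta rho A.
Proof.
move=> nd r th_oc; have [rho rho_oc] := measure_of_distribution nd r.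
exists rho; apply: measure_unique_oc => a b ab.
apply: etrans (measure_addE _ _ _) _.
apply: etrans (f_equal2 _ (th_oc a b ab) (rho_oc a b ab)) _.
by rewrite -EFinD; congr EFin => /=; ring.
Qed.

Lemma setwise_le_complement eta nu : setwise_le eta nu ->
  exists rho : {measure set (measurableTypeR R) -> \bar R},
    forall A, measurable A -> nu A = measure_add eta rho A.
Proof.
move=> le_nu; apply: (@measure_add_distr nu (distr_fun eta) eta); last exact: measure_oc.
  move=> x y xy /=; have : (eta `]x, y]%classic <= nu `]x, y]%classic)%E by exact: le_nu.
  by rewrite !measure_oc// lee_fin; lra.
move=> a e /(distr_fun_rcont nu a) [b ab Fb]; exists b => //=.
have := distr_fun_nondecreasing eta (ltW ab); lra.
Qed.

Lemma setwise_le_integral eta nu f L : finite_first_moment eta ->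
  finite_first_moment nu -> setwise_le eta nu -> lip L f -> (forall x, 0 <= f x) ->
  \int[eta]_x f x <= \int[nu]_x f x.
Proof.
move=> me mn /setwise_le_complement [rho nuE] lf f0.
rewrite -lee_fin -(lip_integralE me lf) -(lip_integralE mn lf).
rewrite [leRHS](eq_measure_integral (measure_add eta rho)); last by move=> A mA _; exact: nuE.
have f0' x : setT x -> (0 <= (f x)%:E)%E by rewrite lee_fin.
rewrite ge0_integral_measure_add//; last by apply/measurable_EFinP; exact: lip_measurable lf.
by rewrite leeDl// integral_ge0.
Qed.

Lemma exists_finite_of_le nu (theta : {measure set (measurableTypeR R) -> \bar R}) :
  (forall A, measurable A -> (theta A <= nu A)%E) ->
  exists theta' : finite_borel R, forall A, theta' A = theta A.
Proof.
move=> le_nu.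
have fin : (theta setT < +oo)%E.
  apply: le_lt_trans (le_nu _ measurableT) _.
  by rewrite -ge0_fin_numE// fin_num_measure.
by exists (mfrestr measurableT fin) => A; exact: (congr1 theta (setIT A)).
Qed.

(** The right derivatives [F] of [pot nu - C] and [D] of [C] add up to [distr_fun nu]. Hence [F] is
    the distribution function of a measure below [nu], with [D] left for the remainder, and its
    potential is [pot nu - C]. *)
Lemma exists_measure_of_pot nu C : finite_first_moment nu -> cvx C ->
  cvx (pot nu \- C) -> (forall x, 0 <= C x <= pot nu x) ->
  exists theta : finite_borel R, [/\ finite_first_moment theta,
    setwise_le theta nu & forall x, pot theta x = pot nu x - C x].
Proof.
move=> m1 cC cP C01.
have sD := right_slope_subgradient cC; have sF := right_slope_subgradient cP.
have rD := right_slope_rcont cC; have rF := right_slope_rcont cP.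
set D := right_slope C in sD rD; set F := right_slope _ in sF rF.
have ndD := subgradient_nondecreasing sD; have ndF := subgradient_nondecreasing sF.
have sFD : subgradient (F \+ D) (pot nu).
  have -> : pot nu = (pot nu \- C) \+ C by apply/funext => x /=; rewrite subrK.
  exact: subgradientD.
have FD x : F x + D x = distr_fun nu x.
  apply/eqP; rewrite eq_le; apply/andP; split.
    exact: (subgradient_le sFD (pot_subgradient m1) (@distr_fun_rcont nu) x).
  by apply: (subgradient_le (pot_subgradient m1) sFD); exact: rcontD.
have DE : distr_fun nu \- F = D by apply/funext => x /=; rewrite -FD addrAC subrr add0r.
have D0 x : 0 <= D x.
  apply: (@subgradient_ge0 _ _ (pot nu x) x sD) => y; first by case/andP: (C01 y).
  by move=> yx; apply: le_trans (pot_nondecreasing m1 yx); case/andP: (C01 y).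
have F0 x : 0 <= F x.
  apply: (@subgradient_ge0 _ _ (pot nu x) x sF) => y /=.
    by rewrite subr_ge0; case/andP: (C01 y).
  move=> yx; apply: le_trans (pot_nondecreasing m1 yx).
  by rewrite gerBl; case/andP: (C01 y).
have [theta0 th_oc] := measure_of_distribution ndF rF.
have [|||rho nuE] := @measure_add_distr nu F theta0; rewrite ?DE//.
have le_nu A : measurable A -> (theta0 A <= nu A)%E.
  move=> mA; rewrite (nuE _ mA); apply: le_trans (_ : theta0 A + rho A <= _)%E.
    by rewrite leeDl.
  by rewrite -measure_addE.
have [theta thE] := exists_finite_of_le le_nu.
exists theta.
have mth : finite_first_moment theta.
  have mid : measurable_fun setT (fun x : measurableTypeR R => `|(x : R)%:E|%E).
    exact: measurable_int (integrable_abse m1).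
  apply/integrableP; split; first by case/integrableP: m1.
  case/integrableP: m1 => _; apply: le_lt_trans.
  rewrite [leRHS](eq_measure_integral (measure_add theta0 rho)); last by move=> A mA _; exact: nuE.
  rewrite ge0_integral_measure_add//.
  rewrite [leLHS](eq_measure_integral theta0); last by move=> A _ _; exact: thE.
  by rewrite leeDl// integral_ge0.
have st : setwise_le theta nu by move=> A mA; rewrite thE le_nu.
split=> //.
(* [distr_fun theta] and [F] differ by a constant, which is 0 because both become small far to the
   left. The same argument fixes the constant between the two potentials. *)
have dF x y : x <= y -> distr_fun theta y - F y = distr_fun theta x - F x.
  move=> xy; have := measure_oc theta xy; rewrite thE th_oc// => -[]; lra.
have dE x : distr_fun theta x = F x.
  apply/eqP; rewrite -subr_eq0 -normr_le0; apply/ler_addgt0Pl => e e0.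
  have e2 : 0 < e / 2 by rewrite divr_gt0.
  have [y yx ye] := distr_fun_small x mth e2.
  have [z zy ze] := distr_fun_small y m1 e2.
  rewrite (dF z x) ?(le_trans zy)// addr0 ler_norml.
  have := distr_fun_nondecreasing theta zy; have := FD z; have := D0 z.
  have := F0 z; have := distr_fun_ge0 theta z; lra.
have sT : subgradient F (pot theta).
  by have := pot_subgradient mth; rewrite (_ : distr_fun theta = F)//; exact/funext.
move=> x; apply/eqP; rewrite -subr_eq0 -normr_le0; apply/ler_addgt0Pl => e e0.
have e2 : 0 < e / 2 by rewrite divr_gt0.
have [y yx ye] := pot_small x mth e2.
have [z zy ze] := pot_small y m1 e2.
rewrite (subgradient_diff sT sF x z) addr0 ler_norml /=.
have := pot_nondecreasing mth zy; have := pot_ge0 theta z; have := C01 z; lra.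
Qed.

End measure_of_potential.

(** * Stability of the shadow *)

Section shadow_stability.
Variable R : realType.
Implicit Types (f F C : R -> R) (eta chi mu nu S : finite_borel R).

Lemma put_cvx (t : R) : cvx (fun k => put k t).
Proof.
move=> x z y xz zy; rewrite /put maxr_pMr ?subr_ge0 ?(le_trans xz)// ge_max.
have h1 : (y - z) * (x - t) <= (y - z) * Num.max (x - t) 0.
  by rewrite ler_wpM2l ?subr_ge0// le_max lexx.
have h2 : (z - x) * (y - t) <= (z - x) * Num.max (y - t) 0.
  by rewrite ler_wpM2l ?subr_ge0// le_max lexx.
rewrite mulr0 addr_ge0 ?andbT; first lra.
- by rewrite mulr_ge0 ?subr_ge0// le_max lexx orbT.
- by rewrite mulr_ge0 ?subr_ge0// le_max lexx orbT.
Qed.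

Lemma subgradient_cvx F f : subgradient F f -> cvx f.
Proof.
move=> Ff x z y xz zy.
have h1 : (y - z) * (f z + F z * (x - z)) <= (y - z) * f x.
  by rewrite ler_wpM2l ?subr_ge0//; have := Ff z x; lra.
have h2 : (z - x) * (f z + F z * (y - z)) <= (z - x) * f y.
  by rewrite ler_wpM2l ?subr_ge0//; have := Ff z y; lra.
lra.
Qed.

(** The convexity defect [D t] of [k |-> put k t] is nonnegative and Lipschitz in [t], so its
    integral against [eta] is at most that against [nu]. *)
Lemma pot_sub_cvx eta nu : finite_first_moment eta -> finite_first_moment nu ->
  setwise_le eta nu -> cvx (pot nu \- pot eta).
Proof.
move=> me mn le_nu x z y xz zy /=.
pose D (t : R) := ((y - z) * put x t + (z - x) * put y t) - (y - x) * put z t.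
have l1 := lipZ (y - z) (put_lip x); have l2 := lipZ (z - x) (put_lip y).
have l3 := lipZ (y - x) (put_lip z).
have lD := lipD (lipD l1 l2) (lipN l3).
have D0 t : 0 <= D t by rewrite subr_ge0; exact: (put_cvx t xz zy).
have DE chi : finite_first_moment chi -> \int[chi]_t D t =
    ((y - z) * pot chi x + (z - x) * pot chi y) - (y - x) * pot chi z.
  move=> mc; rewrite (integralB_lip mc (lipD l1 l2) l3) (integralD_lip mc l1 l2).
  by rewrite !(RintegralZl _ _ (lip_integrable mc (put_lip _))).
have := setwise_le_integral me mn le_nu lD D0.
rewrite (DE _ me) (DE _ mn); lra.
Qed.

Lemma setwise_le_pot eta nu k : finite_first_moment eta -> finite_first_moment nu ->
  setwise_le eta nu -> pot eta k <= pot nu k.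
Proof.
move=> me mn le_nu; apply: setwise_le_integral le_nu (put_lip k) _ => // x.
by rewrite le_max lexx orbT.
Qed.

(* [mass] is the slope of [pot] at +oo. *)
Lemma pot_le_mass eta chi : finite_first_moment eta -> finite_first_moment chi ->
  (forall k, pot eta k <= pot chi k) -> mass eta <= mass chi.
Proof.
move=> me mc le_pot.
have lid : lip 1 (fun x : R => x) by move=> x y; rewrite mul1r.
have labs : lip 1 (fun x : R => `|x|) by move=> x y; rewrite mul1r; exact: ler_dist_dist.
pose c := \int[eta]_x x + \int[chi]_x `|x : R|.
(* [pot eta k] is at least [k * mass eta] minus a constant and [pot chi k] at most [k * mass chi]
   plus a constant; a large [k] then excludes [mass eta > mass chi]. *)
have bound k : 0 <= k -> (mass eta - mass chi) * k <= c.
  move=> k0; have lk := lip_cst k.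
  have h1 : k * mass eta - \int[eta]_x x <= pot eta k.
    rewrite -integral_cstE -(integralB_lip me lk lid).
    apply: le_Rintegral => //.
    - exact: lip_integrable me (lipD lk (lipN lid)).
    - exact: lip_integrable me (put_lip k).
    - by move=> x _; rewrite le_max lexx.
  have h2 : pot chi k <= k * mass chi + \int[chi]_x `|x : R|.
    rewrite -integral_cstE -(integralD_lip mc lk labs).
    apply: le_Rintegral => //.
    - exact: lip_integrable mc (put_lip k).
    - exact: lip_integrable mc (lipD lk labs).
    - move=> x _; rewrite ge_max addr_ge0// andbT lerD2l.
      by rewrite -normrN ler_norm.
  have := le_pot k; rewrite /c; lra.
rewrite leNgt; apply/negP => H; have d0 : 0 < mass eta - mass chi by rewrite subr_gt0.
have c0 : 0 <= c by have := bound 0 (lexx 0); rewrite mulr0.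
have k0 : 0 <= (c + 1) / (mass eta - mass chi) by rewrite divr_ge0 ?(ltW d0)// addr_ge0.
by have := bound _ k0; rewrite [_ * (_ / _)]mulrC divfK ?gt_eqF//; lra.
Qed.

Lemma shadow_pot mu nu S : finite_first_moment mu -> finite_first_moment nu ->
  is_shadow nu mu S -> forall k, pot S k = pot nu k - hull (pot nu \- pot mu) k.
Proof.
move=> mm mn [mS cd_mS le_S minS] k.
have pot_mS := pcd_le_pot mm mS (cd_le_pcd cd_mS).
have pot_Sn x : pot S x <= pot nu x by exact: setwise_le_pot.
have g0 x : 0 <= (pot nu \- pot mu) x.
  by rewrite /= subr_ge0 (le_trans (pot_mS x)).
set C := hull _.
have le_C x : pot nu x - pot S x <= C x.
  apply: (@hull_max _ _ (pot nu \- pot S)); first exact: pot_sub_cvx.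
  by move=> y /=; rewrite lerD2l lerN2.
have Cg x : C x <= pot nu x - pot mu x by exact: hull_le.
have cpot eta : finite_first_moment eta -> cvx (pot eta).
  by move=> me; exact: subgradient_cvx (pot_subgradient me).
have [|||theta [mth le_th potE]] := @exists_measure_of_pot R nu C mn.
- exact: cvx_hull.
- by apply: cvx_sub_hull => //; exact: cpot.
- by move=> x; rewrite hull_ge0//= (le_trans (Cg x))// gerBl pot_ge0.
have pot_mth x : pot mu x <= pot theta x by rewrite potE; have := Cg x; lra.
have pot_thS x : pot theta x <= pot S x by rewrite potE; have := le_C x; lra.
(* Squeeze: the potentials of [mu], [theta], [S] increase in this order, hence so do the masses, and
   those of [mu] and [S] agree. *)
have mass_th : mass mu = mass theta.
  apply/eqP; rewrite eq_le (pot_le_mass mm mth)//= (cd_le_mass cd_mS).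
  exact: pot_le_mass.
have cd_th := cd_le_of_pot mm mth mass_th pot_mth.
have := pcd_le_pot mS mth (cd_le_pcd (minS _ mth cd_th le_th)) k.
by have := pot_thS k; rewrite potE; lra.
Qed.

Lemma W1_ge0 eta chi : finite_first_moment eta -> finite_first_moment chi ->
  (0 <= W1 eta chi)%E.
Proof.
move=> me mc; apply: le_ereal_sup_tmp.
exists `|\int[eta]_x (0 : R)%:E - \int[chi]_x (0 : R)%:E|%E; last exact: abse_ge0.
by exists (fun=> 0) => //= -[x y] _ /=; rewrite subrr normr0 mul1r.
Qed.

Lemma shadow_W1_real mu mu' nu nu' S S' (w1 w2 : R) :
  finite_first_moment mu -> finite_first_moment mu' ->
  finite_first_moment nu -> finite_first_moment nu' -> mass mu = mass mu' ->
  is_shadow nu mu S -> is_shadow nu' mu' S' ->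
  (W1 mu mu' <= w1%:E)%E -> (W1 nu nu' <= w2%:E)%E ->
  (W1 S S' <= (w1 + 2 * w2)%:E)%E.
Proof.
move=> mm mm' mn mn' mass_mu hS hS' W_mu W_nu.
have [mS cd_mS le_S _] := hS; have [mS' cd_mS' le_S' _] := hS'.
have [a1 [b1 [[nda1 ndb1] [a10 b10] ab1 nuE]]] := pot_diff_decomposition mn mn' W_nu.
have [a2 [b2 [[nda2 ndb2] [a20 b20] ab2 muE]]] := pot_diff_decomposition mm mm' W_mu.
pose g := pot nu \- pot mu; pose g' := pot nu' \- pot mu'.
have g0 x : 0 <= g x.
  rewrite subr_ge0; apply: le_trans (setwise_le_pot x mS mn le_S).
  exact: (pcd_le_pot mm mS (cd_le_pcd cd_mS)).
have g'0 x : 0 <= g' x.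
  rewrite subr_ge0; apply: le_trans (setwise_le_pot x mS' mn' le_S').
  exact: (pcd_le_pot mm' mS' (cd_le_pcd cd_mS')).
(* [mu] enters [g] with a minus sign, so its two parts are swapped:
   [g - g' = (a1 - b1) - (a2 - b2) = h' - h]. *)
pose h := b1 \+ a2; pose h' := a1 \+ b2.
have gh : g \+ h = g' \+ h'.
  apply/funext => x; rewrite /g /g' /h /h' /=.
  by have := nuE x; have := muE x; lra.
have ndh : {homo h : x y / x <= y} by move=> x y xy; rewrite lerD ?ndb1 ?nda2.
have ndh' : {homo h' : x y / x <= y} by move=> x y xy; rewrite lerD ?nda1 ?ndb2.
have h0 x : 0 <= h x by rewrite addr_ge0.
have h'0 x : 0 <= h' x by rewrite addr_ge0.
(* Two independent points, compared at their maximum by monotonicity: this bounds the sum of the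
   suprema of [h] and [h'], not only that of their values at one point. *)
have hh' x y : h x + h' y <= w1 + w2.
  have := ndh x (Num.max x y); have := ndh' y (Num.max x y).
  rewrite !le_max !lexx orbT => /(_ isT) l1 /(_ isT) l2.
  apply: le_trans (lerD l2 l1) _; rewrite /h /h' /=.
  by have := ab1 (Num.max x y); have := ab2 (Num.max x y); lra.
pose H := sup (range h).
have hH x : h x <= H.
  by apply: ub_le_sup; [exists (w1 + w2 - h' 0) => _ [y _ <-]; rewrite lerBrDr|exists x].
have h'H x : h' x <= w1 + w2 - H.
  rewrite lerBrDr addrC -lerBrDr; apply: ge_sup; first by exists (h 0), 0.
  by move=> _ [y _ <-]; rewrite lerBrDr.
have gh0 x : 0 <= (g \+ h) x by rewrite addr_ge0.
pose u k := hull (g \+ h) k - hull g k.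
pose v k := hull (g' \+ h') k - hull g' k.
have u0 k : 0 <= u k by rewrite subr_ge0 le_hull// => y; rewrite lerDl.
have v0 k : 0 <= v k by rewrite subr_ge0 le_hull// => y; rewrite lerDl.
have uH k : u k <= H.
  by rewrite lerBlDl hull_le_addC// => y; rewrite lerD2l.
have vH k : v k <= w1 + w2 - H.
  by rewrite lerBlDl hull_le_addC// => y; [rewrite -gh|rewrite lerD2l].
(* Since the hulls of [g + h] and [g' + h'] coincide, the difference of the shadow potentials is
   [(a1 + u) - (b1 + v)]. Here [a1 + b1 <= w2] and [u + v <= w1 + w2]. *)
apply: (@pot_diff_W1 _ S S' (a1 \+ u) (b1 \+ v)) => //.
- by rewrite -(cd_le_mass cd_mS) -(cd_le_mass cd_mS').
- by move=> x y xy; rewrite lerD ?nda1//; exact: hull_add_nondecreasing.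
- move=> x y xy; rewrite lerD ?ndb1//; apply: hull_add_nondecreasing => // z.
  by have := gh0 z; rewrite gh.
- by move=> k; rewrite addr_ge0.
- by move=> k; rewrite addr_ge0.
- by move=> k /=; have := ab1 k; have := uH k; have := vH k; lra.
move=> k; rewrite (shadow_pot mm mn hS) (shadow_pot mm' mn' hS') /u /v gh /=.
by have := nuE k; rewrite -/g -/g'; lra.
Qed.

End shadow_stability.

Theorem theorem3p1 (R : realType) (mu mu' nu nu' S S' : finite_borel R)
  (hmu : finite_first_moment mu) (hmu' : finite_first_moment mu')
  (hnu : finite_first_moment nu) (hnu' : finite_first_moment nu')
  (mass_mu : mu setT = mu' setT) (mass_nu : nu setT = nu' setT)
  (mu_nu : pcd_le mu nu) (mu_nu' : pcd_le mu' nu')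
  (hS : is_shadow nu mu S) (hS' : is_shadow nu' mu' S') :
  (W1 S S' <= W1 mu mu' + 2%:E * W1 nu nu')%E.
Proof.
have mass_mu' : mass mu = mass mu' by rewrite /mass mass_mu.
have W0 := W1_ge0 hmu hmu'; have W0' := W1_ge0 hnu hnu'.
have H (w1 w2 : R) := @shadow_W1_real R _ _ _ _ _ _ w1 w2 hmu hmu' hnu hnu' mass_mu' hS hS'.
(* Nonnegativity excludes [-oo], and an infinite distance makes the right-hand side [+oo]; only the
   case of two real distances has content. *)
case: (W1 mu mu') W0 H => [w1 _|_ _|//]; case: (W1 nu nu') W0' => [w2 _|_|//].
- by move=> /(_ w1 w2); rewrite EFinD EFinM; apply.
- by move=> _; rewrite gt0_muley ?lte_fin// addey// leey.
- by rewrite addye ?leey//.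
- by rewrite addye ?leey// gt0_muley.
Qed.
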